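(* Assume the continuum hypothesis. Then $$\mathrm{Bor}(C(K),\tau_p)\otimes \mathrm{Bor}(C(K),\tau_p)=\mathrm{Bor}(C(K)\times C(K),\tau_p\times\tau_p).$$
   Context: Setting: $E$ is an uncountable abelian group with a total order $\le$ satisfying $a\le b\iff a-b\le 0$ for all $a,b\in E$; the order topology $\tau_0$ (generated by the sets $\{x<a\}$ and $\{x>b\}$, $a,b\in E$) is the group topology, and for it $E$ is locally compact, separable and connected. $\mu=m$ is the Haar measure of $E$. For $t\in E$ let $f^t$ be the characteristic function of $\{u\in E:u>t\}$, and let $A$ be the (norm-closed, unital) $C^*$-subalgebra of the complex space $L^\infty(E,\mu)$ generated by $\{f^t:t\in E\}$. $K=K_\mu(E)$ is the set of characters of $A$ with the weak$^*$ topology $\sigma(A^*,A)$; it is a compact Hausdorff space and $A=C(K)$. $\tau_p$ is the topology of pointwise convergence on $K$. $\mathrm{Bor}(X,\tau)$ is the Borel $\sigma$-algebra of $(X,\tau)$, and $\otimes$ denotes the product $\sigma$-algebra. *)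

(* Defs.v *)
From HB Require Import structures.
From mathcomp Require Import all_boot all_order all_algebra.
From mathcomp Require Import generic_quotient.
From mathcomp Require Import complex.
From mathcomp Require Import all_classical all_reals all_analysis.
From mathcomp Require Import measurable_realfun ess_sup_inf.

Set Implicit Arguments.
Unset Strict Implicit.
Unset Printing Implicit Defensive.

Import Order.TTheory GRing.Theory Num.Theory.
Import numFieldNormedType.Exports.
Import ComplexField.Normc.

Local Open Scope classical_set_scope.
Local Open Scope ring_scope.
Local Open Scope quotient_scope.

Definition continuum_hypothesis (R : realType) : Prop :=
  forall X : set R, countable X \/ (X #= [set: R])%card.

Definition linear_order (T : Type) (le : rel T) : Prop :=
  [/\ reflexive le, antisymmetric le, transitive le & total le].

Section order_rays.
Variables (T : eqType) (le : rel T).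

Definition lray (a : T) : set T := [set x | le x a && (x != a)].
Definition uray (b : T) : set T := [set x | le b x && (x != b)].

Definition topology_axioms (O : set (set T)) : Prop :=
  [/\ O [set: T],
      forall U V, O U -> O V -> O (U `&` V) &
      forall F : set (set T), F `<=` O -> O (\bigcup_(U in F) U)].

(* The open sets of the topology generated by the open rays. *)
Definition order_open : set (set T) :=
  smallest topology_axioms (range lray `|` range uray).

End order_rays.

(* The Borel sigma-algebras of the library live on pointed types. *)
HB.instance Definition _ (E : topologicalZmodType) := isPointed.Build E 0.

Notation borelType X := (g_sigma_algebraType (@open X)).

Definition separable (X : topologicalType) : Prop :=
  exists2 D : set X, countable D & dense D.

(* mu is defined on the Borel sigma-algebra of E; compact sets are Borel as soon
   as E is Hausdorff. *)
Record haar_measure (R : realType) (E : topologicalZmodType)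
    (mu : {measure set (borelType E) -> \bar R}) : Prop := HaarMeasure {
  haar_neq0 : mu [set: E] != 0%E ;
  haar_translation : forall (a : E) (B : set (borelType E)), measurable B ->
    mu [set a + x | x in (B : set E)] = mu B ;
  haar_compact : forall K : set E, compact K -> (mu K < +oo)%E ;
  haar_outer : forall B : set (borelType E), measurable B ->
    mu B = ereal_inf [set mu U | U in [set U : set E | open U /\ B `<=` U]] ;
  haar_inner : forall U : set E, open U ->
    mu U = ereal_sup [set mu K | K in [set K : set E | compact K /\ K `<=` U]]
}.

Section ess_bounded.
Context d (T : measurableType d) (R : realType).
Variable mu : {measure set T -> \bar R}.

Definition ess_bounded : set (T -> R[i]) :=
  [set f : T -> R[i] | [/\ measurable_fun [set: T] (fun x => complex.Re (f x)),
               measurable_fun [set: T] (fun x => complex.Im (f x)) &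
               exists M : R, \forall x \ae mu, normc (f x) <= M]].

Lemma normcD (x y : R[i]) : normc (x + y) <= normc x + normc y.
Proof. by rewrite -lecR rmorphD; exact: (ler_normD x y). Qed.

Lemma normcN (x : R[i]) : normc (- x) = normc x.
Proof. by case: x => a b /=; rewrite !sqrrN. Qed.

Lemma ess_bounded_cst c : ess_bounded (fun=> c).
Proof.
by split; [exact: measurable_cst|exact: measurable_cst|
  exists (normc c); exact: aeW].
Qed.

Lemma ess_boundedD f g :
  ess_bounded f -> ess_bounded g -> ess_bounded (f \+ g).
Proof.
move=> [rf jf [M Mf]] [rg jg [N Ng]]; split.
- under eq_fun do rewrite raddfD/=; exact: measurable_funD.
- under eq_fun do rewrite raddfD/=; exact: measurable_funD.
- exists (M + N); apply: filterS2 Mf Ng => x fM gN.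
  by rewrite (le_trans (normcD _ _))// lerD.
Qed.

Lemma ess_boundedM f g :
  ess_bounded f -> ess_bounded g -> ess_bounded (f \* g).
Proof.
move=> [rf jf [M Mf]] [rg jg [N Ng]]; split.
- rewrite (_ : (fun _ => _) = fun x => complex.Re (f x) * complex.Re (g x) -
      complex.Im (f x) * complex.Im (g x)).
    by apply: measurable_funB; exact: measurable_funM.
  by apply/funext => x /=; case: (f x) (g x) => [a b] [a' b'].
- rewrite (_ : (fun _ => _) = fun x => complex.Re (f x) * complex.Im (g x) +
      complex.Im (f x) * complex.Re (g x)).
    by apply: measurable_funD; exact: measurable_funM.
  by apply/funext => x /=; case: (f x) (g x) => [a b] [a' b'].
- exists (M * N); apply: filterS2 Mf Ng => x fM gN.
  have n0 (z : R[i]) : 0 <= normc z by case: z => a b; exact: sqrtr_ge0.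
  by rewrite /= normcM ler_pM.
Qed.

Lemma ess_bounded_conj f : ess_bounded f -> ess_bounded (fun x => conjc (f x)).
Proof.
move=> [rf jf [M Mf]]; split.
- rewrite (_ : (fun _ => _) = fun x => complex.Re (f x))//.
  by apply/funext => x; case: (f x).
- rewrite (_ : (fun _ => _) = fun x => - complex.Im (f x)).
    exact: measurable_funN.
  by apply/funext => x; case: (f x).
- exists M; apply: filterS Mf => x.
  by case: (f x) => a b /=; rewrite sqrrN.
Qed.

Lemma ess_bounded_indic (D : set T) : measurable D -> ess_bounded \1_D.
Proof.
move=> mD; split.
- rewrite (_ : (fun _ => _) = \1_D); first exact: measurable_indic.
  by apply/funext => x; rewrite !indicE; case: (_ \in _).
- rewrite (_ : (fun _ => _) = cst 0); first exact: measurable_cst.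
  by apply/funext => x; rewrite !indicE; case: (_ \in _).
- exists 1; apply: aeW => x; rewrite indicE.
  by case: (_ \in _); rewrite ?normc1 ?normc0.
Qed.

Lemma ess_bounded_subring : subring_closed [in ess_bounded].
Proof.
split=> [|f g|f g]; rewrite !inE.
- exact: ess_bounded_cst.
- move=> bf bg; rewrite (_ : f - g = f \+ (cst (-1) \* g)).
    exact: ess_boundedD bf (ess_boundedM (ess_bounded_cst _) bg).
  by apply/funext => x /=; rewrite mulN1r.
- exact: ess_boundedM.
Qed.

Lemma ess_bounded_submod : subsemimod_closed [in ess_bounded].
Proof.
split=> [|k f]; last first.
  by rewrite !inE => bf; exact: (ess_boundedM (ess_bounded_cst k) bf).
split=> [|f g]; rewrite !inE; first exact: ess_bounded_cst.
exact: ess_boundedD.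
Qed.

Definition ess_bounded_fun : Type := ess_bounded.
HB.instance Definition _ := SubChoice.on ess_bounded_fun.
HB.instance Definition _ := GRing.SubChoice_isSubComPzRing.Build
  (T -> R[i]) _ ess_bounded_fun ess_bounded_subring.
HB.instance Definition _ := GRing.SubZmodule_isSubLmodule.Build R[i]
  (T -> R[i]) _ ess_bounded_fun ess_bounded_submod.

End ess_bounded.


Section Linfty.
Context d (T : measurableType d) (R : realType).
Variable mu : {measure set T -> \bar R}.
Local Notation fT := (ess_bounded_fun mu).

Definition ae_equal (f g : fT) : bool := `[< val f = val g %[ae mu] >].

Lemma ae_equal_refl : reflexive ae_equal.
Proof. by move=> f; apply/asboolP; exact: ae_eq_refl. Qed.

Lemma ae_equal_sym : symmetric ae_equal.
Proof. by move=> f g; apply/asboolP/asboolP => h; exact: ae_eq_sym. Qed.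

Lemma ae_equal_trans : transitive ae_equal.
Proof.
move=> g f h /asboolP fg /asboolP gh; apply/asboolP; exact: ae_eq_trans fg gh.
Qed.

Canonical ae_equal_equiv :=
  EquivRel ae_equal ae_equal_refl ae_equal_sym ae_equal_trans.

(* The complex L^infty space: classes of essentially bounded functions modulo
   almost everywhere equality. *)
Definition Linfty : Type := {eq_quot ae_equal}.
HB.instance Definition _ := Choice.on Linfty.
HB.instance Definition _ := EqQuotient.on Linfty.

Lemma Linfty_eqP (f g : fT) :
  reflect (val f = val g %[ae mu]) (f == g %[mod Linfty]).
Proof. by rewrite eqmodE; exact: asboolP. Qed.

Lemma Linfty_reprE (f : fT) : val (repr (\pi_Linfty f)) = val f %[ae mu].
Proof. by apply/Linfty_eqP; rewrite reprK. Qed.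

Definition Linfty_opp := lift_op1 Linfty -%R.
Definition Linfty_add := lift_op2 Linfty +%R.
Definition Linfty_mul := lift_op2 Linfty *%R.
Definition Linfty_scale (k : R[i]) := lift_op1 Linfty ( *:%R k).

Definition fun_conj (f : fT) : fT :=
  exist _ (fun x => conjc (val f x)) (mem_set (ess_bounded_conj (set_mem (valP f)))).

Definition Linfty_conj := lift_op1 Linfty fun_conj.

Lemma pi_Linfty_opp : {morph \pi_Linfty : f / - f >-> Linfty_opp f}.
Proof.
move=> f; unlock Linfty_opp; apply/eqP/Linfty_eqP.
by apply: filterS (Linfty_reprE f) => x fx Dx /=; rewrite /GRing.opp/= fx.
Qed.
Canonical pi_Linfty_opp_morph := PiMorph1 pi_Linfty_opp.

Lemma pi_Linfty_add : {morph \pi_Linfty : f g / f + g >-> Linfty_add f g}.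
Proof.
move=> f g; unlock Linfty_add; apply/eqP/Linfty_eqP.
apply: filterS2 (Linfty_reprE f) (Linfty_reprE g) => x fx gx Dx.
by transitivity (val f x + val g x) => //; rewrite -fx// -gx.
Qed.
Canonical pi_Linfty_add_morph := PiMorph2 pi_Linfty_add.

Lemma pi_Linfty_mul : {morph \pi_Linfty : f g / f * g >-> Linfty_mul f g}.
Proof.
move=> f g; unlock Linfty_mul; apply/eqP/Linfty_eqP.
apply: filterS2 (Linfty_reprE f) (Linfty_reprE g) => x fx gx Dx.
by transitivity (val f x * val g x) => //; rewrite -fx// -gx.
Qed.
Canonical pi_Linfty_mul_morph := PiMorph2 pi_Linfty_mul.

Lemma pi_Linfty_scale k :
  {morph \pi_Linfty : f / k *: f >-> Linfty_scale k f}.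
Proof.
move=> f; unlock Linfty_scale; apply/eqP/Linfty_eqP.
apply: filterS (Linfty_reprE f) => x fx Dx.
by transitivity (k * val f x) => //; rewrite -fx.
Qed.
Canonical pi_Linfty_scale_morph k := PiMorph1 (pi_Linfty_scale k).

Lemma pi_Linfty_conj :
  {morph \pi_Linfty : f / fun_conj f >-> Linfty_conj f}.
Proof.
move=> f; unlock Linfty_conj; apply/eqP/Linfty_eqP.
by apply: filterS (Linfty_reprE f) => x fx Dx /=; rewrite fx.
Qed.
Canonical pi_Linfty_conj_morph := PiMorph1 pi_Linfty_conj.

Fact Linfty_addA : associative Linfty_add.
Proof. by do 3![elim/quotW=> ?]; rewrite !piE addrA. Qed.

Fact Linfty_addC : commutative Linfty_add.
Proof. by do 2![elim/quotW=> ?]; rewrite !piE addrC. Qed.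

Fact Linfty_add0 : left_id (\pi_Linfty 0) Linfty_add.
Proof. by elim/quotW=> f; rewrite !piE add0r. Qed.

Fact Linfty_addN : left_inverse (\pi_Linfty 0) Linfty_opp Linfty_add.
Proof. by elim/quotW=> f; rewrite !piE addNr. Qed.

HB.instance Definition _ := GRing.isZmodule.Build Linfty
  Linfty_addA Linfty_addC Linfty_add0 Linfty_addN.

Fact Linfty_mulA : associative Linfty_mul.
Proof. by do 3![elim/quotW=> ?]; rewrite !piE mulrA. Qed.

Fact Linfty_mulC : commutative Linfty_mul.
Proof. by do 2![elim/quotW=> ?]; rewrite !piE mulrC. Qed.

Fact Linfty_mul1 : left_id (\pi_Linfty 1) Linfty_mul.
Proof. by elim/quotW=> f; rewrite !piE mul1r. Qed.

Fact Linfty_mulDl : left_distributive Linfty_mul Linfty_add.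
Proof. by do 3![elim/quotW=> ?]; rewrite !piE mulrDl. Qed.

HB.instance Definition _ := GRing.Zmodule_isComPzRing.Build Linfty
  Linfty_mulA Linfty_mulC Linfty_mul1 Linfty_mulDl.

Fact Linfty_scaleA a b v :
  Linfty_scale a (Linfty_scale b v) = Linfty_scale (a * b) v.
Proof. by elim/quotW: v => v; rewrite !piE scalerA. Qed.

Fact Linfty_scale1 : left_id 1 Linfty_scale.
Proof. by elim/quotW=> v; rewrite !piE scale1r. Qed.

Fact Linfty_scaleDr : right_distributive Linfty_scale +%R.
Proof.
move=> a; elim/quotW=> u; elim/quotW=> v.
by rewrite /GRing.add/= !piE scalerDr.
Qed.

Fact Linfty_scaleDl v : {morph Linfty_scale^~ v : a b / a + b}.
Proof.
elim/quotW: v => v a b.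
by rewrite [RHS]/GRing.add/= !piE scalerDl.
Qed.

HB.instance Definition _ := GRing.Zmodule_isLmodule.Build R[i] Linfty
  Linfty_scaleA Linfty_scale1 Linfty_scaleDr Linfty_scaleDl.

(* As an extended real: the essential supremum is -oo when mu = 0. *)
Definition Linfty_norm (a : Linfty) : \bar R :=
  ess_sup mu (fun x => (normc (val (repr a) x))%:E).

Record unital_Cstar_subalgebra (S : set Linfty) : Prop := {
  Cstar_one : S 1 ;
  Cstar_add : forall a b : Linfty, S a -> S b -> S (a + b) ;
  Cstar_scale : forall (k : R[i]) (a : Linfty), S a -> S (k *: a) ;
  Cstar_mul : forall a b : Linfty, S a -> S b -> S (a * b) ;
  Cstar_conj : forall a : Linfty, S a -> S (Linfty_conj a) ;
  Cstar_closed : forall a : Linfty,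
    (forall e : R, 0 < e -> exists2 b, S b & (Linfty_norm (a - b)%R < e%:E)%E) ->
    S a
}.

Section generated.
Variable G : set Linfty.

Definition Cstar_generated : set Linfty := smallest unital_Cstar_subalgebra G.

Lemma Cstar_generated_subring : subring_closed [in Cstar_generated].
Proof.
have CN S a : unital_Cstar_subalgebra S -> S a -> S (- a).
  by move=> CS Sa; rewrite -scaleN1r; exact: Cstar_scale.
split=> [|a b|a b]; rewrite !inE.
- by move=> S [CS _]; exact: Cstar_one.
- by move=> Ga Gb S [CS GS]; apply: Cstar_add=> //; [exact: Ga|apply: CN => //; exact: Gb].
- by move=> Ga Gb S [CS GS]; apply: Cstar_mul=> //; [exact: Ga|exact: Gb].
Qed.

Lemma Cstar_generated_submod : subsemimod_closed [in Cstar_generated].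
Proof.
split=> [|k a]; last first.
  by rewrite !inE => Ga S [CS GS]; apply: Cstar_scale => //; exact: Ga.
split=> [|a b]; rewrite !inE.
- move=> S [CS _]; have := Cstar_scale CS 0 (Cstar_one CS).
  by rewrite scale0r.
- by move=> Ga Gb S [CS GS]; apply: Cstar_add=> //; [exact: Ga|exact: Gb].
Qed.

Definition Cstar_type : Type := Cstar_generated.
HB.instance Definition _ := SubChoice.on Cstar_type.
HB.instance Definition _ := GRing.SubChoice_isSubComPzRing.Build
  Linfty _ Cstar_type Cstar_generated_subring.
HB.instance Definition _ := GRing.SubZmodule_isSubLmodule.Build R[i]
  Linfty _ Cstar_type Cstar_generated_submod.

(* The topology of set_type is the one induced by the ambient space, so that
   character_space carries the weak-* topology sigma(A^*, A), i.e. pointwise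
   convergence on A; likewise Cp below carries the pointwise topology. *)
Definition characters : set {ptws Cstar_type -> R[i]^o} :=
  [set phi : Cstar_type -> R[i] |
    [/\ forall k (a b : Cstar_type), phi (k *: a + b) = k * phi a + phi b,
        forall a b : Cstar_type, phi (a * b) = phi a * phi b &
        exists a : Cstar_type, phi a != 0]].

Definition character_space : Type := characters.
HB.instance Definition _ := Topological.on character_space.

End generated.
End Linfty.

(* The classes of the functions f^t; uray le t is open, hence Borel, when the
   topology of E is the order topology, and then every f^t is in L^infty. *)
Definition ray_classes (R : realType) (E : topologicalZmodType)
    (mu : {measure set (borelType E) -> \bar R}) (le : rel E) :
    set (Linfty mu) :=
  [set \pi_(Linfty mu) f | f in
    [set f : ess_bounded_fun mu | exists t, val f = \1_(uray le t)]].
Arguments ray_classes {R E} mu le.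

Section Cp.
Variables (K : topologicalType) (R : realType).

Definition Cp_set : set {ptws K -> R[i]^o} :=
  [set f : K -> R[i]^o | continuous f].

Definition Cp : Type := Cp_set.
HB.instance Definition _ := Topological.on Cp.

Fact Cp_set0 : Cp_set (fun=> 0).
Proof. by move=> x; exact: cvg_cst. Qed.

HB.instance Definition _ :=
  isPointed.Build Cp (SigSub (mem_set Cp_set0)).

End Cp.

(* Main.v *)
Require Import Defs.
From HB Require Import structures.
From mathcomp Require Import all_boot all_order all_algebra.
From mathcomp Require Import generic_quotient.
From mathcomp Require Import complex.
From mathcomp Require Import all_classical all_reals all_analysis.
From mathcomp Require Import measurable_realfun ess_sup_inf.
From mathcomp Require Import wochoice lra.
Import Order.TTheory GRing.Theory Num.Theory.
Import numFieldNormedType.Exports.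
Import ComplexField.Normc.

Local Open Scope classical_set_scope.
Local Open Scope ring_scope.
Local Open Scope quotient_scope.

Set Implicit Arguments.
Unset Strict Implicit.
Unset Printing Implicit Defensive.

(** Rectangles of Borel sets are Borel because the projections are continuous;
the point is that every open set O of pairs of functions is in the product
sigma-algebra, although O is an uncountable union of open rectangles.

Under the continuum hypothesis a set W of the cardinality of the continuum has
a total order with countable initial segments, and then, by the argument of
Kunen and Rao, every subset of W x W is in the sigma-algebra generated by all
rectangles: below the diagonal it is a countable union of graphs of partial
functions, and likewise above it ([fully_measurable_pair]). Call a map into W
fully measurable if the preimages of all subsets are measurable. Finite tuples
of fully measurable maps are fully measurable, so a set that is open for the
initial topology of countably many fully measurable maps into the discrete
space W is measurable ([measurable_fully_measurable_open]). It remains to find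
countably many fully measurable maps on C(K) whose initial topology is at least
as fine as pointwise convergence.

A character of A is determined by the cut of all t at which the idempotent f^t
takes the value 1, so K is a compact space of cuts of E, essentially the split
interval. Let h be continuous on K, and let k be the upper side of a gap at x.
Near k, h is nearly constant to the right of the gap. If h is also nearly
constant a bit to the left, then so it is on a clopen strip whose end points
are in a countable dense subset of E, and there are countably many strips.
Otherwise h really jumps at x: some such strip is cut by x into a right part,
on which the distance from h to a rational q is at most some tolerance, and a
left part, on which it is at least twice that much. For given strip, q and
tolerances, the location x of this jump is a function of h, and it is fully
measurable although there are uncountably many locations. Indeed let P be the
open set of functions for which some point of the strip at distance less than
the larger tolerance has, at or to its right, a point at distance more than the
smaller one, and let W(x) be the open set of those at distance more than the
smaller tolerance on the lower side of x and less than the larger one on the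
upper side. The functions in W(x) but not in P are those that jump at x, so
every union of jump sets is a difference of two open sets
([measurable_jump_at]). The location, coded by its comparisons with the dense
sequence, together with the bounds of h on strips, gives the required countable
family ([code_separates]). Lower sides of gaps are handled by reversing the
order.

On the side of the algebra, characters are bounded by the norm, as 1 - a is
invertible in A when a has norm less than 1 ([char_eval_bound]). This makes K
compact ([compact_characters]) and shows that the values at the f^t determine
the topology of K ([cvg_characters]). *)

(** * Total orders with countable initial segments *)

Section binary_in_real.
Variable R : realType.
Implicit Types b : nat -> bool.

Let w (n : nat) : R := 3%:R ^- n.

Let psum b (n : nat) : R := \sum_(k < n) (b k)%:R * w k.

Let psumS b n : psum b n.+1 = psum b n + (b n)%:R * w n.
Proof. by rewrite /psum big_ord_recr. Qed.

Let w_gt0 n : 0 < w n.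
Proof. by rewrite invr_gt0 exprn_gt0. Qed.

Let wS n : w n = 3 * w n.+1.
Proof. by rewrite /w exprS invfM mulrA divff ?mul1r. Qed.

Let psum_tail b n m : psum b (n + m)%N <= psum b n + (3 / 2) * w n - (3 / 2) * w (n + m)%N.
Proof.
elim: m => [|m IH]; first by rewrite addn0; lra.
rewrite addnS psumS; have := wS (n + m)%N; have := w_gt0 (n + m)%N.
by case: (b _) => /=; lra.
Qed.

Let psum_homo b n m : psum b n <= psum b (n + m)%N.
Proof.
elim: m => [|m IH]; first by rewrite addn0.
by rewrite addnS psumS (le_trans IH)// lerDl mulr_ge0// ltW.
Qed.

Definition ternary_sum b : R := sup [set psum b n | n in [set: nat]].

Let psum_ub b n : ubound [set psum b n | n in [set: nat]] (psum b n + (3 / 2) * w n).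
Proof.
move=> _ [m _ <-]; have [nm|mn] := leqP n m.
  rewrite -(subnKC nm); have := psum_tail b n (m - n)%N.
  have := w_gt0 (n + (m - n))%N; lra.
rewrite -(subnKC (ltnW mn)); have := psum_homo b m (n - m)%N.
have := w_gt0 (m + (n - m))%N; lra.
Qed.

Let psum_le b n : psum b n <= ternary_sum b.
Proof. by apply: ub_le_sup; [exists (psum b 0 + (3/2) * w 0); exact: psum_ub|exists n]. Qed.

Let le_psum b n : ternary_sum b <= psum b n + (3 / 2) * w n.
Proof. by apply: ge_sup; [exists (psum b 0), 0%N|exact: psum_ub]. Qed.

(** The tail after the n-th digit is at most half of the n-th power of 1/3, so
the first digit that differs decides. *)
Lemma ternary_sum_inj : injective ternary_sum.
Proof.
move=> b b' e; apply/funext; apply: contrapT => /existsNP ex.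
have exn : exists n, b n != b' n by case: ex => n /eqP; exists n.
case: (ex_minnP exn) => n nb nmin.
have agree m : (m <= n)%N -> psum b m = psum b' m.
  elim: m => [|m IH] mn; first by rewrite /psum !big_ord0.
  rewrite !psumS IH ?(ltnW mn)//; suff -> : b m = b' m by [].
  by apply/eqP; apply: contraTT mn => /nmin; rewrite -leqNgt.
have := agree n (leqnn n); move: nb e.
have := psum_le b n.+1; have := psum_le b' n.+1.
have := le_psum b n.+1; have := le_psum b' n.+1; rewrite !psumS.
have := wS n; have := w_gt0 n.+1.
by case: (b n); case: (b' n) => //=; lra.
Qed.

End binary_in_real.

Definition countable_segments (T : Type) (le : rel T) : Prop :=
  total le /\ forall x, countable [set y | le y x].

Lemma countable_preimage (T U : Type) (f : T -> U) (A : set U) :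
  injective f -> countable A -> countable (f @^-1` A).
Proof.
move=> fI /countable_injP[h hI]; apply/countable_injP; exists (h \o f) => x y.
by rewrite !inE => Ax Ay /hI; rewrite !inE => /(_ Ax Ay)/fI.
Qed.

Lemma countable_segments_pullback (T U : Type) (f : T -> U) (le : rel U) :
  injective f -> countable_segments le ->
  countable_segments (fun x y => le (f x) (f y)).
Proof.
move=> fI [tle cle]; split=> [x y|x]; first exact: tle.
exact: (countable_preimage fI (cle (f x))).
Qed.

(** In a well-order of the reals either all initial segments are countable, or
the first uncountable one has, by the hypothesis, as many elements as the line,
and the order of this segment is transported to the line. *)
Lemma CH_countable_segments (R : realType) : continuum_hypothesis R ->
  exists le : rel R, countable_segments le.
Proof.
move=> CH; have [le wo] := well_ordering_principle R.
have tot : total le.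
  move=> x y; have [|z [[zxy zmin] _]] := wo [pred a | (a == x) || (a == y)].
    by exists x; rewrite inE eqxx.
  have := zmin x; have := zmin y; rewrite !inE !eqxx orbT => /(_ isT) zy /(_ isT) zx.
  by move: zxy; rewrite inE => /orP[] /eqP <-; rewrite ?zy ?zx ?orbT.
have anti x y : le x y -> le y x -> x = y.
  move=> xy yx; have [|z [_ zu]] := wo [pred a | (a == x) || (a == y)].
    by exists x; rewrite inE eqxx.
  have rf a : le a a by have := tot a a; rewrite orbb.
  transitivity z; [apply/esym|]; apply: zu; split=> [|a]; rewrite !inE ?eqxx ?orbT//;
    by move=> /orP[] /eqP ->.
have [call|/existsNP[x0 nx0]] := pselect (forall x, countable [set y | le y x]).
  by exists le.
have [|m [[/asboolP nm mmin] _]] := wo [pred x | `[< ~ countable [set y | le y x] >]].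
  by exists x0; apply/asboolP.
pose S := [set y | le y m /\ y <> m].
have cS y : S y -> countable [set z | le z y].
  move=> [ym nym]; apply: contrapT => ncy; apply: nym; apply: anti => //.
  by apply: mmin; apply/asboolP.
have [cntS|] := CH S.
  exfalso; apply: nm; have -> : [set y | le y m] = S `|` [set m].
    apply/seteqP; split=> [y ym|y [[]//|->]] /=.
      by have [->|/eqP] := eqVneq y m; [right|left].
    by have := tot m m; rewrite orbb.
  by rewrite -bigcup2E; apply: bigcup_countable => // -[|[|i]] _ //=.
move=> /card_esym/card_set_bijP [g [gS gI _]].
have gI' : injective g by move=> x y; apply: gI; rewrite inE.
exists (fun a b => le (g a) (g b)); split=> [a b|a]; first exact: tot.
exact: (countable_preimage gI' (cS _ (gS a I))).
Qed.

(** * Maps all of whose preimages are measurable *)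

Definition fully_measurable d (S : measurableType d) (T : Type) (f : S -> T) :=
  forall A : set T, measurable (f @^-1` A).

Section kunen.
Context d (S : measurableType d).
Variable le : rel (nat -> bool).
Hypothesis le_segments : countable_segments le.

(** Points of the Cantor set are separated by countably many sets, the values of
their coordinates. *)
Lemma fully_measurable_graph (f : S -> nat -> bool) g : fully_measurable f ->
  fully_measurable g -> measurable [set w | f w = g w].
Proof.
move=> mf mg; have -> : [set w | f w = g w] =
    \bigcap_n ((f @^-1` [set b | b n] `&` g @^-1` [set b | b n]) `|`
               (f @^-1` [set b | ~ b n] `&` g @^-1` [set b | ~ b n])).
  apply/seteqP; split=> [w /= fg n _|w fg] /=; rewrite ?fg.
    by case: (g w n); [left|right].
  by apply/funext => n; move: (fg n I) => /=; case: (f w n); case: (g w n) => // -[[]|[]].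
apply: bigcap_measurableType => n _.
by apply: measurableU; apply: measurableI.
Qed.

(** The predecessors of x are enumerated as e x 0, e x 1, and so on; on the set
where g w = e (f w) n membership in P is a condition on f w alone. *)
Let fully_measurable_below (f : S -> nat -> bool) g 
    (P : set ((nat -> bool) * (nat -> bool))) : fully_measurable f ->
  fully_measurable g -> measurable [set w | P (f w, g w) /\ le (g w) (f w)].
Proof.
move=> mf mg; have [_ cle] := le_segments.
have /choice[e eP] : forall x, exists e : nat -> nat -> bool,
    forall y, le y x -> exists n, e n = y.
  move=> x; have /countable_injP[h hI] := cle x.
  exists (fun n => get [set y | le y x /\ h y = n]) => y yx; exists (h y).
  have [/= gx gh] : [set z | le z x /\ h z = h y] (get [set z | le z x /\ h z = h y]).
    by apply: getPex; exists y.
  by apply: hI => //; rewrite inE.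
have -> : [set w | P (f w, g w) /\ le (g w) (f w)] =
  \bigcup_n ([set w | e (f w) n = g w] `&` f @^-1` [set x | P (x, e x n) /\ le (e x n) x]).
  apply/seteqP; split=> [w [Pw lw]|w [n _ [/= -> ]]]//.
  by have [n en] := eP _ _ lw; exists n => //; split=> //=; rewrite en.
apply: bigcup_measurable => n _; apply: measurableI; last exact: mf.
by apply: fully_measurable_graph => // A; apply: (mf ((e^~ n) @^-1` A)).
Qed.

Lemma fully_measurable_pair (f g : S -> nat -> bool) : fully_measurable f ->
  fully_measurable g -> fully_measurable (fun w => (f w, g w)).
Proof.
move=> mf mg P; have [tle _] := le_segments.
have -> : (fun w => (f w, g w)) @^-1` P =
    [set w | P (f w, g w) /\ le (g w) (f w)] `|`
    [set w | [set z | P (z.2, z.1)] (g w, f w) /\ le (f w) (g w)].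
  apply/seteqP; split=> [w Pw|w [[]|[]]//] /=.
  by have /orP[h|h] := tle (f w) (g w); [right|left].
by apply: measurableU; exact: fully_measurable_below.
Qed.

Definition interleave (a b : nat -> bool) (n : nat) : bool :=
  if odd n then b n./2 else a n./2.

Lemma interleave_inj a b a' b' :
  interleave a b = interleave a' b' -> a = a' /\ b = b'.
Proof.
move=> e; split; apply/funext => n.
  by have := congr1 (@^~ n.*2) e; rewrite /interleave odd_double doubleK.
have := congr1 (@^~ n.*2.+1) e; rewrite /interleave /= odd_double /=.
by rewrite uphalf_double.
Qed.

(** Finitely many of the maps are coded by one fully measurable map into the
Cantor set, and U is a union of preimages under these countably many codes. *)
Lemma measurable_fully_measurable_open (I : countType) (xi : I -> S -> nat -> bool)
    (U : set S) : (forall i, fully_measurable (xi i)) ->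
  (forall w, U w -> exists s : seq I, forall w',
    {in s, forall i, xi i w' = xi i w} -> U w') ->
  measurable U.
Proof.
move=> mxi Uxi.
pose code s w := foldr (fun i b => interleave (xi i w) b) (fun=> false) s.
have mcode s : fully_measurable (code s).
  elim: s => [|i s IH] A /=.
    rewrite (_ : _ @^-1` A = if `[< A (fun=> false) >] then setT else set0).
      by case: ifP.
    by case: asboolP => h; apply/seteqP; split.
  exact: (fully_measurable_pair (mxi i) IH [set z | A (interleave z.1 z.2)]).
have code_inj s w w' : code s w = code s w' -> {in s, forall i, xi i w = xi i w'}.
  elim: s => [//|i s IH] /= /interleave_inj[e /IH h] j.
  by rewrite inE => /orP[/eqP -> //|]; exact: h.
have -> : U = \bigcup_s (code s @^-1` [set b | forall w, code s w = b -> U w]).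
  apply/seteqP; split=> [w Uw|w [s _]]; last exact.
  by have [s sU] := Uxi w Uw; exists s => //= w' /code_inj/sU.
by apply: countable_bigcupT_measurable => // s; exact: mcode.
Qed.

End kunen.

(** * Complex numbers and pointwise convergence *)

Lemma normc_ge0 (R : realType) (z : R[i]) : 0 <= normc z.
Proof. by case: z => a b; exact: sqrtr_ge0. Qed.

Lemma normc_dist (R : realType) (a b : R[i]) : normc (a - b) = normc (b - a).
Proof. by rewrite -normcN opprB. Qed.

Lemma normc_triangle (R : realType) (a b c : R[i]) :
  normc (a - c) <= normc (a - b) + normc (b - c).
Proof. by apply: le_trans (normcD _ _); rewrite addrA subrK. Qed.

Lemma nbhs_normc (R : realType) (z : R[i]^o) (A : set R[i]^o) :
  nbhs z A <-> exists2 e : R, 0 < e & forall w, normc (w - z) < e -> A w.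
Proof.
split=> [/nbhs_normP[e /= e0 eA]|[e e0 eA]].
  have [r0 er] : 0 < complex.Re e /\ e = (complex.Re e)%:C%C.
    by move: e0; rewrite ltcE /= => /andP[/eqP i0 ?]; split=> //; case: (e) i0 => a b /= ->.
  exists (complex.Re e) => // w wz; apply: eA => /=.
  by rewrite er distrC ltcR.
apply/nbhs_ballP; exists (e%:C)%C => /=; first by rewrite ltcR.
by move=> w; rewrite -ball_normE /= distrC ltcR; exact: eA.
Qed.

Lemma cvg_subspace_ptws (U : Type) (V : topologicalType) (A : set {ptws U -> V})
    (F : set_system A) (f : A) : Filter F ->
  (forall u, (set_val g : U -> V) u @[g --> F] --> (set_val f : U -> V) u) -> F --> f.
Proof.
move=> FF Ff B [_ [[C oC <-]] /= Cf CB].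
have : (set_val g : {ptws U -> V}) @[g --> F] --> (set_val f : {ptws U -> V}).
  apply/cvg_sup => u D [_ [[Q oQ <-]] /= Qf QD].
  have FQ := Ff u Q (open_nbhs_nbhs (conj oQ Qf)).
  by apply: (@filterS _ F _ _ _ _ FQ) => g; exact: QD.
move=> /(_ C (open_nbhs_nbhs (conj oC Cf))) FC.
by apply: (@filterS _ F _ _ _ _ FC) => g; exact: CB.
Qed.

Lemma continuous_eval_subspace_ptws (U : Type) (V : topologicalType)
  (A : set {ptws U -> V}) (u : U) : continuous (fun g : A => (set_val g : U -> V) u).
Proof.
move=> g; apply: (@continuous_comp _ _ _ (set_val : A -> {ptws U -> V}) (fun h => h u)).
  exact: initial_continuous.
have /cvg_sup/(_ u) h : nbhs (set_val g : {ptws U -> V}) --> (set_val g : {ptws U -> V}).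
  exact: cvg_id.
move=> B; rewrite nbhsE => -[C [oC Cg] CB]; apply: h.
exists ((fun h => h u) @^-1` C); split; last by move=> k; exact: CB.
  by exists C.
exact: Cg.
Qed.

(** * Continuous functions on a space of cuts *)

Section distance.
Context (R : realType) (X : topologicalType).
Implicit Types (f : X -> R[i]^o) (q : R[i]) (r : R).

Lemma nbhs_dist_lt f q r x : {for x, continuous f} -> normc (f x - q) < r ->
  \forall y \near x, normc (f y - q) < r.
Proof.
move=> cf xr; apply: (cf [set z : R[i]^o | normc (z - q) < r]).
apply/nbhs_normc; exists (r - normc (f x - q)) => [|w wx /=]; first by rewrite subr_gt0.
have := normc_triangle w (f x) q; lra.
Qed.

Lemma nbhs_dist_gt f q r x : {for x, continuous f} -> r < normc (f x - q) ->
  \forall y \near x, r < normc (f y - q).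
Proof.
move=> cf xr; apply: (cf [set z : R[i]^o | r < normc (z - q)]).
apply/nbhs_normc; exists (normc (f x - q) - r) => [|w wx /=]; first by rewrite subr_gt0.
have := normc_triangle (f x) w q; rewrite (normc_dist (f x) w); lra.
Qed.

End distance.

Definition rat_complex (R : realType) (q : rat * rat) : R[i] :=
  (ratr q.1 +i* ratr q.2)%C.

Lemma normc_le_ReIm (R : realType) (a b : R) : normc (a +i* b)%C <= `|a| + `|b|.
Proof.
rewrite /= -[leRHS]ger0_norm ?addr_ge0// -sqrtr_sqr ler_wsqrtr//.
by rewrite sqrrD !real_normK ?num_real// addrAC lerDl mulrn_wge0// mulr_ge0.
Qed.

Lemma rat_complex_dense (R : realType) (z : R[i]) (e : R) : 0 < e ->
  exists q, normc (z - rat_complex R q) < e.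
Proof.
case: z => a b e0.
have near_rat (x : R) : exists q, `|x - ratr q| < e / 2.
  have [|q] := @rat_in_itvoo R (x - e / 2) (x + e / 2); first by lra.
  by rewrite in_itv /= => /andP[q1 q2]; exists q; rewrite ltr_norml; apply/andP; split; lra.
have [q1 h1] := near_rat a; have [q2 h2] := near_rat b; exists (q1, q2).
by apply: le_lt_trans (normc_le_ReIm _ _) _; rewrite /=; lra.
Qed.

(** The point k stands for the initial segment of all x with c k x. Whether a
point contains a given x is a clopen condition, and these conditions generate
the topology; the ends s and t of a basic neighbourhood may be missing. *)
Record cut_space (K : topologicalType) (E : Type) (le : rel E)
    (c : K -> E -> bool) (d : nat -> E) : Prop := CutSpace {
  cut_le : linear_order le ;
  cut_mono : forall k x y, le x y -> c k y -> c k x ;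
  cut_nbhs_in : forall k x, c k x -> \forall k' \near k, c k' x ;
  cut_nbhs_out : forall k x, ~~ c k x -> \forall k' \near k, ~~ c k' x ;
  cut_base : forall k (U : set K), nbhs k U -> exists s t : option E,
    [/\ oapp (c k) true s, ~~ oapp (c k) false t &
     forall k', oapp (c k') true s -> ~~ oapp (c k') false t -> U k'] ;
  cut_dense : forall x y, ~~ le y x -> exists n, ~~ le (d n) x /\ ~~ le y (d n)
}.

Lemma cut_space_reverse (K : topologicalType) (E : Type) (le : rel E)
    (c : K -> E -> bool) (d : nat -> E) : cut_space le c d ->
  cut_space (fun x y => le y x) (fun k x => ~~ c k x) d.
Proof.
move=> [[r a tr tot] m ni no b dns]; split.
- split=> [x|x y /andP[h1 h2]|y x z h1 h2|x y].
  + exact: r.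
  + by apply: a; rewrite h1 h2.
  + exact: tr h2 h1.
  + exact: tot.
- by move=> k x y yx; apply: contra => /(m _ _ _ yx).
- by move=> k x /no.
- by move=> k x; rewrite negbK => /ni; apply: filterS => k'; rewrite negbK.
- move=> k U /b[s [t [ks kt kU]]]; exists t, s; split.
  + by case: (t) kt.
  + by case: (s) ks => //= x ->.
  + move=> k' kt' ks'; apply: kU; first by case: (s) ks' => //= x; rewrite negbK.
    by case: (t) kt'.
- by move=> x y /dns[n [h1 h2]]; exists n.
Qed.

Local Notation ev h k := ((set_val h : _ -> _) k).

Section cut_function_space.
Context (R : realType) (K : topologicalType).
Hypothesis Kcompact : compact [set: K].
Context (E : Type) (le : rel E) (c : K -> E -> bool) (d : nat -> E).
Hypothesis cutK : cut_space le c d.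
Implicit Types (h : Cp K R) (q : R[i]) (r : R) (x y : E).

Let lexx x : le x x. Proof. by have [[r _ _ _] *] := cutK; exact: r. Qed.
Let le_anti x y : le x y -> le y x -> x = y.
Proof. by have [[_ a _ _] *] := cutK; apply: a; apply/andP. Qed.
Let nle x y : ~~ le x y -> le y x.
Proof. by have [[_ _ _ t] _ _ _ _ _] := cutK; have /orP[->//|->] := t x y. Qed.

Lemma continuous_Cp h : continuous (set_val h : K -> R[i]^o).
Proof. by have := set_mem (valP h). Qed.

Lemma continuous_ev (k : K) : continuous (fun h => ev h k : R[i]^o).
Proof. exact: continuous_eval_subspace_ptws. Qed.

Lemma measurable_open_Cp (U : set (Cp K R)) : open U ->
  measurable (U : set (borelType (Cp K R))).
Proof. exact: sub_sigma_algebra. Qed.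

Lemma open_Cp_dist_lt k q r : open [set h : Cp K R | normc (ev h k - q) < r].
Proof. by rewrite openE => h; exact: nbhs_dist_lt (@continuous_ev k h). Qed.

Lemma open_Cp_dist_gt k q r : open [set h : Cp K R | r < normc (ev h k - q)].
Proof. by rewrite openE => h; exact: nbhs_dist_gt (@continuous_ev k h). Qed.

(** The points that contain the left end and not the right end, where both ends
are terms of d or missing: there are countably many strips. *)
Definition strip (o1 o2 : option nat) (k : K) : bool :=
  oapp (c k \o d) true o1 && ~~ oapp (c k \o d) false o2.

(** The points l and m are the two sides of the gap at x. The middle zone, between
r and 2 r, which h does not enter on the strip, makes the location x unique and
the jump detectable by strict inequalities at l and m. *)
Definition jump_at (o1 o2 : option nat) q r x h : Prop :=
  [/\ exists2 l, strip o1 o2 l & forall y, c l y = ~~ le x y,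
      exists2 m, strip o1 o2 m & forall y, c m y = le y x &
      forall k, strip o1 o2 k ->
        if c k x then normc (ev h k - q) <= r else 2 * r <= normc (ev h k - q)].

Lemma jump_at_unique o1 o2 q r x y h : 0 < r ->
  jump_at o1 o2 q r x h -> jump_at o1 o2 q r y h -> x = y.
Proof.
move=> r0 [[l Nl cl] [m Nm cm] hx] [_ _ hy].
apply: le_anti.
  apply/negPn/negP; rewrite -cl => ly.
  by have := hx _ Nl; have := hy _ Nl; rewrite ly cl lexx /=; lra.
apply/negPn/negP; rewrite -cm => my.
by have := hx _ Nm; have := hy _ Nm; rewrite (negbTE my) cm lexx /=; lra.
Qed.

(** A function in W goes from distance more than r at l to distance less than
2 r at m. In P, somewhere on the strip distance less than 2 r is followed by
distance more than r; outside P the values at l and m therefore propagate to the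
whole strip on both sides of x. *)
Lemma measurable_jump_at o1 o2 q r (A : set E) : 0 < r ->
  measurable ([set h : Cp K R | exists2 x, A x & jump_at o1 o2 q r x h]
    : set (borelType (Cp K R))).
Proof.
move=> r0.
pose P := [set h : Cp K R | exists k k', [/\ strip o1 o2 k, strip o1 o2 k',
  (forall y, c k y -> c k' y), normc (ev h k - q) < 2 * r &
  r < normc (ev h k' - q)]].
pose W := [set h : Cp K R | exists2 x, A x & exists l m, [/\ strip o1 o2 l, strip o1 o2 m,
  (forall y, c l y = ~~ le x y), (forall y, c m y = le y x) &
  r < normc (ev h l - q) /\ normc (ev h m - q) < 2 * r]].
have oP : open P.
  rewrite openE => h [k [k' [Nk Nk' kk' hk hk']]].
  have := open_Cp_dist_lt k q (2 * r); rewrite openE => /(_ _ hk) nk.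
  have := open_Cp_dist_gt k' q r; rewrite openE => /(_ _ hk') nk'.
  by apply: filterS2 nk nk' => g gk gk'; exists k, k'.
have oW : open W.
  rewrite openE => h [x Ax [l [m [Nl Nm cl cm [hl hm]]]]].
  have := open_Cp_dist_lt m q (2 * r); rewrite openE => /(_ _ hm) nm.
  have := open_Cp_dist_gt l q r; rewrite openE => /(_ _ hl) nl.
  by apply: filterS2 nm nl => g gm gl; exists x => //; exists l, m.
have -> : [set h : Cp K R | exists2 x, A x & jump_at o1 o2 q r x h] = W `\` P.
  apply/seteqP; split=> [h [x Ax [[l Nl cl] [m Nm cm] hx]]|h []].
    split.
      exists x => //; exists l, m; split=> //.
      by have := hx _ Nl; have := hx _ Nm; rewrite cl cm lexx /=; lra.
    move=> [k [k' [Nk Nk' kk' hk hk']]].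
    have := hx _ Nk; case: ifPn => [/kk' ckx _|_]; last by lra.
    by have := hx _ Nk'; rewrite ckx; lra.
  move=> [x Ax [l [m [Nl Nm cl cm [hl hm]]]]] nP; exists x => //; split.
  - by exists l.
  - by exists m.
  move=> k Nk; case: ifPn => ckx; rewrite leNgt; apply/negP => hk; apply: nP.
    exists m, k; split=> // y; rewrite cm => yx.
    exact: (cut_mono cutK yx).
  exists k, l; split=> // y cky; rewrite cl; apply: contra ckx => xy.
  exact: (cut_mono cutK xy).
by apply: measurableD; exact: measurable_open_Cp.
Qed.

(** Coordinate 0 tells whether there is a jump; the others locate it among the
terms of d. *)
Definition jump_code (o1 o2 : option nat) q r h (n : nat) : bool :=
  `[< exists2 x, jump_at o1 o2 q r x h & (if n is n'.+1 then ~~ le x (d n') else true) : bool >].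

Lemma jump_codeE o1 o2 q r x h n : 0 < r -> jump_at o1 o2 q r x h ->
  jump_code o1 o2 q r h n = if n is n'.+1 then ~~ le x (d n') else true.
Proof.
move=> r0 hx; apply/asboolP/idP => [[y hy]|hn]; last by exists x.
by rewrite (jump_at_unique r0 hx hy).
Qed.

Lemma jump_code_inj o1 o2 q r x h h' : 0 < r -> jump_at o1 o2 q r x h ->
  jump_code o1 o2 q r h' = jump_code o1 o2 q r h -> jump_at o1 o2 q r x h'.
Proof.
move=> r0 hx hh'.
have /asboolP[y hy _] : jump_code o1 o2 q r h' 0%N by rewrite hh' (jump_codeE _ r0 hx).
have xy n : le x (d n) = le y (d n).
  apply: negb_inj; rewrite -(jump_codeE n.+1 r0 hx) -(jump_codeE n.+1 r0 hy).
  by rewrite hh'.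
rewrite (_ : x = y)//; apply: le_anti; apply/negPn/negP => /(cut_dense cutK)[n [h1 h2]].
  by move: h2; rewrite xy (nle h1).
by move: h2; rewrite -xy (nle h1).
Qed.

(** The preimage of A is a union of jump sets, together with the complement of
all of them when the code of the absence of jumps is in A. *)
Lemma fully_measurable_jump_code o1 o2 q r : 0 < r ->
  fully_measurable (jump_code o1 o2 q r : borelType (Cp K R) -> nat -> bool).
Proof.
move=> r0 A.
pose code x := fun n => if n is n'.+1 then ~~ le x (d n') else true.
have codeE x h : jump_at o1 o2 q r x h -> jump_code o1 o2 q r h = code x.
  by move=> hx; apply/funext => n; exact: jump_codeE.
have code0 h : ~ (exists2 x, setT x & jump_at o1 o2 q r x h) ->
    jump_code o1 o2 q r h = fun=> false.
  move=> nh; apply/funext => n; apply/asboolP => -[x hx _].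
  by apply: nh; exists x.
have -> : jump_code o1 o2 q r @^-1` A =
    [set h | exists2 x, A (code x) & jump_at o1 o2 q r x h] `|`
    (if `[< A (fun=> false) >]
     then ~` [set h | exists2 x, setT x & jump_at o1 o2 q r x h] else set0).
  apply/seteqP; split=> [h /= Ah|h /= [[x Ax hx]|]].
  - have [[x _ hx]|nh] := pselect (exists2 x, setT x & jump_at o1 o2 q r x h).
      by left; exists x; rewrite -?(codeE _ _ hx).
    by right; move: Ah; rewrite code0// => /asboolT ->.
  - by rewrite (codeE _ _ hx).
  - by case: asboolP => // A0 nh; rewrite code0.
apply: measurableU; first exact: measurable_jump_at.
case: ifP => _ //; apply: measurableC; exact: measurable_jump_at.
Qed.

Definition flat_code (o1 o2 : option nat) q r h (n : nat) : bool :=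
  `[< forall k, strip o1 o2 k -> normc (ev h k - q) <= r >].

Lemma fully_measurable_flat_code o1 o2 q r :
  fully_measurable (flat_code o1 o2 q r : borelType (Cp K R) -> nat -> bool).
Proof.
move=> A.
pose P := [set h : Cp K R | exists2 k, strip o1 o2 k & r < normc (ev h k - q)].
have mP : measurable (P : set (borelType (Cp K R))).
  apply: measurable_open_Cp; rewrite openE => h [k Nk hk].
  have := open_Cp_dist_gt k q r; rewrite openE => /(_ _ hk).
  by apply: filterS => g gk; exists k.
have codeE h : flat_code o1 o2 q r h = fun=> ~~ `[< P h >].
  apply/funext => n; apply/asboolP/negP => [hN /asboolP[k Nk]|nP k Nk].
    by rewrite ltNge hN.
  by rewrite leNgt; apply/negP => hk; apply: nP; apply/asboolP; exists k.
have -> : flat_code o1 o2 q r @^-1` A =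
    (P `&` [set h | A (fun=> false)]) `|` (~` P `&` [set h | A (fun=> true)]).
  apply/seteqP; split=> [h /=|h /=]; rewrite codeE.
    by case: asboolP => Ph; [left|right].
  by move=> [[Ph]|[Ph]]; case: asboolP.
have mcst (Q : Prop) : measurable ([set h | Q] : set (borelType (Cp K R))).
  have [q1|q0] := pselect Q.
    by rewrite (_ : [set _ | _] = setT)//; apply/seteqP; split.
  by rewrite (_ : [set _ | _] = set0)//; apply/seteqP; split.
by apply: measurableU; apply: measurableI => //; exact: measurableC.
Qed.

(** For a point with distance less than r, distance at most 3 r on a whole strip
is the other outcome of the dichotomy in [cut_code_gap]; the values r, 2 r, 3 r
leave room for a limit argument between them. *)
Definition cut_code (jump : bool) (o1 o2 : option nat) (p : rat * rat) (n : nat) :=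
  if jump then jump_code o1 o2 (rat_complex R p) n.+1%:R^-1
  else flat_code o1 o2 (rat_complex R p) (3 * n.+1%:R^-1).

Lemma fully_measurable_cut_code jump o1 o2 p n :
  fully_measurable (cut_code jump o1 o2 p n : borelType (Cp K R) -> nat -> bool).
Proof.
case: jump; last exact: fully_measurable_flat_code.
by apply: fully_measurable_jump_code; rewrite invr_gt0 ltr0n.
Qed.

(** A left end that is not the maximum of the initial segment can be moved to the
right, to a term of d. *)
Lemma approx_below k (s : option E) : oapp (c k) true s ->
  ~ (exists x, forall y, c k y = le y x) ->
  exists2 o, oapp (c k \o d) true o &
    forall k', oapp (c k' \o d) true o -> oapp (c k') true s.
Proof.
case: s => [x /= kx nmax|_ _]; last by exists None.
have [y ky yx] : exists2 y, c k y & ~~ le y x.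
  apply: contrapT => nex; apply: nmax; exists x => y; apply/idP/idP => [ky|yx].
    by apply: contrapT => /negP yx; apply: nex; exists y.
  exact: (cut_mono cutK yx).
have [n [nx yn]] := cut_dense cutK yx.
exists (Some n) => [|k' /=]; last exact: (cut_mono cutK (nle nx)).
exact: (cut_mono cutK (nle yn) ky).
Qed.

Lemma choose_scale h k (e : R) : 0 < e -> exists p n,
  [/\ normc (ev h k - rat_complex R p) < n.+1%:R^-1 & 4 * n.+1%:R^-1 < e].
Proof.
move=> e0; have e40 : 0 < e / 4 by lra.
have [n ne] := ltr_add_invr e40.
have n0 : 0 < n.+1%:R^-1 :> R by rewrite invr_gt0 ltr0n.
have [q hq] := rat_complex_dense (ev h k) n0.
by exists q, n; split=> //; move: (n.+1%:R^-1) ne => w; lra.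
Qed.

(** As the order is dense, no point is both the upper side of a gap and the lower
side of another one. *)
Lemma cut_ge_nmin k x : (forall y, c k y = le y x) ->
  ~ (exists x, forall y, ~~ c k y = le x y).
Proof.
move=> kx [y ky]; have /negP : ~~ c k y by rewrite ky.
rewrite kx => /negP/(cut_dense cutK)[n [nx yn]].
by have := ky (d n); rewrite kx (negbTE yn) nx.
Qed.

Let nbhs_oapp l o : oapp (c l \o d) false o ->
  \forall k' \near l, oapp (c k' \o d) false o.
Proof. by case: o => [j|//]; exact: (cut_nbhs_in cutK). Qed.

(** If on no strip around k the function stays within 3 r of q, then by
compactness points of distance more than 3 r accumulate from the left at a point
l, which is the lower side of the gap, and h jumps there. *)
Lemma cut_code_gap k x h (e : R) : 0 < e -> (forall y, c k y = le y x) ->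
  (forall t, ~~ oapp (c k) false t -> exists2 o, ~~ oapp (c k \o d) false o &
    forall k', ~~ oapp (c k' \o d) false o -> ~~ oapp (c k') false t) ->
  exists jump o1 o2 p n, forall h',
    cut_code jump o1 o2 p n h' = cut_code jump o1 o2 p n h ->
    normc (ev h' k - ev h k) < e.
Proof.
move=> e0 kx above.
have [p [n [hp ne]]] := choose_scale h k e0; move: hp ne.
set q := rat_complex R p; set r := _^-1 => hq re.
have r0 : 0 < r by rewrite invr_gt0 ltr0n.
have [s [t [ks kt kU]]] := cut_base cutK (nbhs_dist_lt (@continuous_Cp h k) hq).
have [ o2 ko2 o2P] := above t kt.
have upper k' : c k' x -> ~~ oapp (c k' \o d) false o2 ->
    normc (ev h k' - q) < r.
  move=> k'x k'o2; apply: kU; last exact: o2P.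
  by case: s ks => //= y; rewrite kx => yx; exact: (cut_mono cutK yx).
have dist h' w : normc (ev h' k - q) <= w * r -> w <= 3 -> normc (ev h' k - ev h k) < e.
  move=> hw w3; have := normc_triangle (ev h' k) q (ev h k).
  rewrite (normc_dist q) => /le_lt_trans; apply; nra.
have [[ o1 [ko1 o1P]]|nflat] := pselect (exists o1, oapp (c k \o d) true o1 /\
    forall k', strip o1 o2 k' -> normc (ev h k' - q) <= 3 * r).
  exists false, o1, o2, p, n => h' /(congr1 (@^~ 0%N)) hh'.
  have /asboolP/(_ k) : cut_code false o1 o2 p n h' 0%N by rewrite hh'; apply/asboolP.
  by rewrite /strip ko1 ko2 => /(_ isT)/dist; exact.
(* The points left of the gap, right of o1, at which h is far from q. *)
pose B o1 := [set k' | [/\ strip o1 o2 k', ~~ c k' x & 3 * r < normc (ev h k' - q)]].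
have B0 o1 : oapp (c k \o d) true o1 -> B o1 !=set0.
  move=> ko1; apply: contrapT => B0; apply: nflat; exists o1; split=> // k' k'N.
  rewrite leNgt; apply/negP => hk'; apply: B0; exists k'; split=> //.
  apply/negP => /upper; have /andP[_ k'o2] := k'N => /(_ k'o2); lra.
pose F := filter_from [set o1 | oapp (c k \o d) true o1] B.
have FF : ProperFilter F.
  apply: filter_from_proper => [|//]; apply: filter_from_filter; first by exists None.
  have subB o o' : (forall k', oapp (c k' \o d) true o -> oapp (c k' \o d) true o') ->
      B o `<=` B o'.
    by move=> oo' k' [/andP[k'o k'o2] ? ?]; split=> //; rewrite /strip oo'.
  move=> [i|] [j|] /= ki kj.
  - have : le (d i) (d j) || le (d j) (d i) by have [[_ _ _ tot] _ _ _ _ _] := cutK; exact: tot.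
    move=> /orP[ij|ji]; [exists (Some j)|exists (Some i)] => // k' Bk'; split=> //.
      by apply: subB Bk' => k'' /=; exact: (cut_mono cutK ij).
    by apply: subB Bk' => k'' /=; exact: (cut_mono cutK ji).
  - by exists (Some i) => // k' Bk'; split=> //; exact: subB Bk'.
  - by exists (Some j) => // k' Bk'; split=> //; exact: subB Bk'.
  - by exists None => // k' Bk'.
have [l [_ lF]] := Kcompact FF filterT.
have FB o1 : oapp (c k \o d) true o1 -> F (B o1) by exists o1.
have lx : ~~ c l x.
  apply/negP => /(cut_nbhs_in cutK) lx.
  by have [k' [[_ /negP]]] := lF _ _ (FB None isT) lx.
have cl y : c l y = ~~ le x y.
  apply/idP/idP => [ly|]; first by apply: contra lx => xy; exact: (cut_mono cutK xy).
  move=> /(cut_dense cutK)[i [iy xi]]; apply/negPn/negP => /(cut_nbhs_out cutK) ly.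
  have ki : c k (d i) by rewrite kx; exact: nle.
  have [k' [[/andP[/= k'i _] _ _] /negP]] := lF _ _ (FB (Some i) ki) ly; apply.
  by apply: (cut_mono cutK) k'i; exact: nle.
have lo2 : ~~ oapp (c l \o d) false o2.
  apply/negP => /nbhs_oapp lo2.
  have [k' [[/andP[_ /negP]]]] := lF _ _ (FB None isT) lo2; exact.
have lq : 2 * r < normc (ev h l - q).
  rewrite ltNge; apply/negP => hl.
  have hl3 : normc (ev h l - q) < 3 * r by lra.
  have [k' [[_ _ h1] h2]] := lF _ _ (FB None isT) (nbhs_dist_lt (@continuous_Cp h l) hl3).
  by move: h1; rewrite ltNge (ltW h2).
have [s' [t' [ls lt lU]]] := cut_base cutK (nbhs_dist_gt (@continuous_Cp h l) lq).
have [|o1 lo1 o1P] := approx_below ls.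
  move=> [y ly]; have : ~~ le x y by rewrite -cl ly.
  move=> /(cut_dense cutK)[i [iy xi]].
  by move: (ly (d i)); rewrite cl xi (negbTE iy).
have lower k' : ~~ c k' x -> oapp (c k' \o d) true o1 -> 2 * r < normc (ev h k' - q).
  move=> k'x k'o1; apply: lU; first exact: o1P.
  case: t' lt => //= y; rewrite cl negbK => xy; apply: contra k'x.
  exact: (cut_mono cutK xy).
have ko1 : oapp (c k \o d) true o1.
  by case: (o1) lo1 => //= i; rewrite cl kx; exact: nle.
exists true, o1, o2, p, n => h' hh'.
have hJ : jump_at o1 o2 q r x h.
  split.
  - by exists l => //; rewrite /strip lo1.
  - by exists k => //; rewrite /strip ko1.
  move=> k' /andP[k'o1 k'o2]; case: ifPn => k'x; apply: ltW; first exact: upper.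
  exact: lower.
have [_ _ /(_ k)] := jump_code_inj r0 hJ hh'.
rewrite /strip ko1 ko2 kx lexx => /(_ isT) hk; apply: (dist h' 1); lra.
Qed.

(** Here both ends of a basic neighbourhood can be moved to terms of d, so the
neighbourhood contains a strip around k. *)
Lemma cut_code_nogap k h (e : R) : 0 < e ->
  ~ (exists x, forall y, c k y = le y x) ->
  (forall t, ~~ oapp (c k) false t -> exists2 o, ~~ oapp (c k \o d) false o &
    forall k', ~~ oapp (c k' \o d) false o -> ~~ oapp (c k') false t) ->
  exists jump o1 o2 p n, forall h',
    cut_code jump o1 o2 p n h' = cut_code jump o1 o2 p n h ->
    normc (ev h' k - ev h k) < e.
Proof.
move=> e0 kx above.
have [p [n [hp ne]]] := choose_scale h k e0; move: hp ne.
set q := rat_complex R p; set r := _^-1 => hq re.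
have r0 : 0 < r by rewrite invr_gt0 ltr0n.
have [s [t [ks kt kU]]] := cut_base cutK (nbhs_dist_lt (@continuous_Cp h k) hq).
have [ o2 ko2 o2P] := above t kt; have [ o1 ko1 o1P] := approx_below ks kx.
exists false, o1, o2, p, n => h' /(congr1 (@^~ 0%N)) hh'.
have /asboolP/(_ k) : cut_code false o1 o2 p n h' 0%N.
  rewrite hh'; apply/asboolP => k' /andP[k'o1 k'o2]; apply: ltW.
  apply: (lt_le_trans (kU k' _ _)); [exact: o1P|exact: o2P|rewrite -/r; lra].
rewrite /strip ko1 ko2 => /(_ isT); rewrite -/q -/r => h'q.
have := normc_triangle (ev h' k) q (ev h k).
rewrite (normc_dist q); lra.
Qed.

End cut_function_space.

(** * Borel sets of pairs of functions *)

Section separating_codes.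
Context (R : realType) (K : topologicalType) (E : Type) (le : rel E)
  (c : K -> E -> bool) (d : nat -> E).
Hypothesis Kcompact : compact [set: K].
Hypothesis cutK : cut_space le c d.
Implicit Types (h : Cp K R) (k : K).

(** The first component selects the given or the reversed order. *)
Definition code_index : countType :=
  (bool * bool * (option nat * option nat) * (rat * rat) * nat)%type.

Definition code (i : code_index) : Cp K R -> nat -> bool :=
  let: (upward, jump, o, p, n) := i in
  cut_code (if upward then le else fun x y => le y x)
    (if upward then c else fun k x => ~~ c k x) d jump o.1 o.2 p n.

Lemma fully_measurable_code i :
  fully_measurable (code i : borelType (Cp K R) -> nat -> bool).
Proof.
case: i => [[[[[] jump] o] p] n]; first exact: (fully_measurable_cut_code cutK).
exact: (fully_measurable_cut_code (cut_space_reverse cutK)).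
Qed.

Lemma approx_above k (t : option E) : ~~ oapp (c k) false t ->
  ~ (exists x, forall y, ~~ c k y = le x y) ->
  exists2 o, ~~ oapp (c k \o d) false o &
    forall k', ~~ oapp (c k' \o d) false o -> ~~ oapp (c k') false t.
Proof.
have oappN (T : Type) (f : T -> bool) o : oapp (fun x => ~~ f x) true o = ~~ oapp f false o.
  by case: o.
rewrite -oappN => kt /(approx_below (cut_space_reverse cutK) kt)[ o ko kP].
exists o => [|k']; first by rewrite -oappN.
by rewrite -!oappN; exact: kP.
Qed.

(** Upper sides of gaps are treated in the given order, lower sides in the
reversed order, and the remaining points in either. *)
Lemma code_separates k h (e : R) : 0 < e ->
  exists i, forall h', code i h' = code i h -> normc (ev h' k - ev h k) < e.
Proof.
move=> e0; have rK := cut_space_reverse cutK.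
have [[x kx]|nmax] := pselect (exists x, forall y, c k y = le y x).
  have [|j [ o1 [ o2 [p [n jP]]]]] := cut_code_gap Kcompact cutK h e0 kx.
    by move=> t kt; apply: approx_above kt (cut_ge_nmin cutK kx).
  by exists (true, j, (o1, o2), p, n).
have [[x kx]|nmin] := pselect (exists x, forall y, ~~ c k y = le x y).
  have [|j [ o1 [ o2 [p [n jP]]]]] := cut_code_gap Kcompact rK h e0 kx.
    have oappN (T : Type) (f : T -> bool) o : ~~ oapp (fun x => ~~ f x) false o = oapp f true o.
      by case: o => //= a; rewrite negbK.
    move=> t; rewrite oappN => /(approx_below cutK)/(_ nmax)[ o ko kP].
    exists o => [|k']; first by rewrite (oappN _ (c k \o d)).
    by rewrite oappN (oappN _ (c k' \o d)); exact: kP.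
  by exists (false, j, (o1, o2), p, n).
have [|j [ o1 [ o2 [p [n jP]]]]] := cut_code_nogap cutK h e0 nmax.
  by move=> t kt; exact: approx_above.
by exists (true, j, (o1, o2), p, n).
Qed.

(** The initial topology of the codes, with discrete range, is at least as
fine as pointwise convergence. *)
Lemma nbhs_code h (U : set (Cp K R)) : nbhs h U -> exists s : seq code_index,
  forall h', {in s, forall i, code i h' = code i h} -> U h'.
Proof.
pose F : set_system (Cp K R) := [set V | exists s : seq code_index,
  forall h', {in s, forall i, code i h' = code i h} -> V h'].
have FF : Filter F.
  split; first by exists [::].
    move=> V W [s sV] [t tW]; exists (s ++ t) => h' st; split; [apply: sV|apply: tW];
      by move=> i si; apply: st; rewrite mem_cat si ?orbT.
  by move=> V W VW [s sV]; exists s => h' /sV/VW.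
suff Fh : F --> h by move=> /Fh.
apply: cvg_subspace_ptws => k B /nbhs_normc[e e0 eB].
have [i iP] := code_separates k h e0; exists [:: i] => h' /(_ i).
by rewrite inE eqxx => /(_ isT)/iP/eB.
Qed.

Lemma measurable_prod_open_Cp (ord : rel (nat -> bool)) (U : set (Cp K R * Cp K R)%type) :
  countable_segments ord -> open U ->
  measurable (U : set (borelType (Cp K R) * borelType (Cp K R))).
Proof.
move=> ordP; rewrite openE => oU.
pose code2 (bi : bool * code_index) (w : borelType (Cp K R) * borelType (Cp K R)) :=
  code bi.2 (if bi.1 then w.1 else w.2).
apply: (measurable_fully_measurable_open ordP (xi := code2)).
  move=> [[] i] A; rewrite /code2 /=.
    have := @measurable_fst _ _ (borelType (Cp K R)) (borelType (Cp K R))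
      measurableT _ (@fully_measurable_code i A).
    by rewrite setTI.
  have := @measurable_snd _ _ (borelType (Cp K R)) (borelType (Cp K R))
    measurableT _ (@fully_measurable_code i A).
  by rewrite setTI.
move=> [f g] /oU[[V W] /= [nV nW] VWU].
have [s sV] := nbhs_code nV; have [t tW] := nbhs_code nW.
exists ([seq (true, i) | i <- s] ++ [seq (false, i) | i <- t]) => -[f' g'] st.
apply: VWU; split=> /=; [apply: sV|apply: tW] => i is_.
  by apply: (st (true, i)); rewrite mem_cat map_f.
by apply: (st (false, i)); rewrite mem_cat map_f ?orbT.
Qed.

End separating_codes.

HB.instance Definition _ (X Y : ptopologicalType) := Pointed.on (X * Y)%type.

Lemma measurable_fun_borel (X Y : ptopologicalType) (f : X -> Y) : continuous f ->
  measurable_fun setT (f : borelType X -> borelType Y).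
Proof.
move=> /continuousP cf.
apply: (@measurability _ _ (borelType X) (borelType Y) setT f (@open Y) erefl).
move=> _ [V oV <-]; rewrite setTI; apply: sub_sigma_algebra; exact: cf.
Qed.

Lemma prod_borel_subset (X Y : ptopologicalType) :
  (measurable : set (set (borelType X * borelType Y))) `<=`
  <<s @open (X * Y)%type >>.
Proof.
rewrite measurable_prod_measurableType; apply: smallest_sub.
  exact: smallest_sigma_algebra.
move=> _ [A mA [B mB <-]].
have -> : A `*` B = fst @^-1` A `&` snd @^-1` B by [].
have cf : continuous (@fst X Y) by move=> x; exact: cvg_fst.
have cs : continuous (@snd X Y) by move=> x; exact: cvg_snd.
have m1 := @measurable_fun_borel (X * Y)%type X fst cf measurableT A mA.
have m2 := @measurable_fun_borel (X * Y)%type Y snd cs measurableT B mB.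
rewrite !setTI in m1 m2; exact: measurableI m1 m2.
Qed.

Theorem cut_space_prod_borel (R : realType) (K : topologicalType) (E : Type)
    (le : rel E) (c : K -> E -> bool) (d : nat -> E) :
  continuum_hypothesis R -> compact [set: K] -> cut_space le c d ->
  (measurable : set (set (borelType (Cp K R) * borelType (Cp K R)))) =
  <<s @open (Cp K R * Cp K R)%type >>.
Proof.
move=> CH Kc cutK; have [leR /(countable_segments_pullback (@ternary_sum_inj R)) segs] :=
  CH_countable_segments CH.
apply/seteqP; split; first exact: prod_borel_subset.
apply: smallest_sub.
  split; [exact: measurable0|by move=> A mA; rewrite setTD; exact: measurableC|].
  by move=> F mF; exact: bigcupT_measurable.
by move=> U oU; exact: (measurable_prod_open_Cp Kc cutK segs oU).
Qed.

(** * The algebra of essentially bounded functions *)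

Section Linfty_calculus.
Context d (T : measurableType d) (R : realType) (mu : {measure set T -> \bar R}).
Local Notation fT := (ess_bounded_fun mu).
Local Notation L := (Linfty mu).

Lemma pi_LinftyD (f g : fT) : \pi_L (f + g) = \pi_L f + \pi_L g.
Proof. exact: pi_Linfty_add. Qed.

Lemma pi_LinftyB (f g : fT) : \pi_L (f - g) = \pi_L f - \pi_L g.
Proof. by rewrite pi_LinftyD; congr (_ + _); exact: pi_Linfty_opp. Qed.

Lemma pi_LinftyM (f g : fT) : \pi_L (f * g) = \pi_L f * \pi_L g.
Proof. exact: pi_Linfty_mul. Qed.

Lemma pi_LinftyZ (k : R[i]) (f : fT) : \pi_L (k *: f) = k *: \pi_L f.
Proof. exact: pi_Linfty_scale. Qed.

Lemma Linfty_norm_le (f : fT) (e : R) :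
  (\forall x \ae mu, normc (val f x) <= e) -> (Linfty_norm (\pi_L f) <= e%:E)%E.
Proof.
move=> fe; apply/ess_supP; apply: filterS2 fe (Linfty_reprE f) => x fx /(_ I) rx.
by rewrite lee_fin rx.
Qed.

Lemma Linfty_norm_lt (a : L) (e : R) :
  (Linfty_norm a < e%:E)%E -> \forall x \ae mu, normc (val (repr a) x) <= e.
Proof. by move=> /ltW/ess_supP; apply: filterS => x; rewrite lee_fin. Qed.

Lemma Linfty_norm_finite (a : L) : exists2 e : R, 0 < e & (Linfty_norm a < e%:E)%E.
Proof.
have [_ _ [M aM]] := set_mem (valP (repr a)).
exists (`|M| + 1); first by rewrite ltr_wpDl.
rewrite -[a]reprK; apply: (le_lt_trans (Linfty_norm_le (e := M) aM)).
by rewrite lte_fin ltr_pwDr// ler_norm.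
Qed.

Lemma Linfty_norm_conjB (a b : L) (e : R) : (Linfty_norm (a - b)%R < e%:E)%E ->
  (Linfty_norm (Linfty_conj a - Linfty_conj b)%R <= e%:E)%E.
Proof.
elim/quotW: a => f; elim/quotW: b => g fg.
have -> : Linfty_conj (\pi_L f) - Linfty_conj (\pi_L g) = \pi_L (fun_conj f - fun_conj g).
  by rewrite pi_LinftyB !pi_Linfty_conj.
apply: Linfty_norm_le.
have := Linfty_norm_lt fg; rewrite -pi_LinftyB => h.
apply: filterS2 h (Linfty_reprE (f - g)) => x h1 /(_ I) h2.
have : normc (val (f - g) x) <= e by rewrite -h2.
rewrite (_ : val (f - g) x = val f x - val g x)//.
rewrite (_ : val (fun_conj f - fun_conj g) x = conjc (val f x) - conjc (val g x))//.
by rewrite -rmorphB; case: (_ - _) => u v /=; rewrite sqrrN.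
Qed.

Lemma Linfty_conj1 : Linfty_conj (1 : L) = 1.
Proof.
transitivity (Linfty_conj (\pi_L (1 : fT))); first by [].
rewrite -pi_Linfty_conj; transitivity (\pi_L (1 : fT)); last by [].
by congr (\pi_L _); apply: val_inj; apply/funext => x; exact: (rmorph1 (@conjc R)).
Qed.

Lemma Linfty_conjD (a b : L) : Linfty_conj (a + b) = Linfty_conj a + Linfty_conj b.
Proof.
elim/quotW: a => f; elim/quotW: b => g.
rewrite -pi_LinftyD -!pi_Linfty_conj -pi_LinftyD; congr (\pi_L _).
by apply: val_inj; apply/funext => x; exact: (rmorphD (@conjc R)).
Qed.

Lemma Linfty_conjM (a b : L) : Linfty_conj (a * b) = Linfty_conj a * Linfty_conj b.
Proof.
elim/quotW: a => f; elim/quotW: b => g.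
rewrite -pi_LinftyM -!pi_Linfty_conj -pi_LinftyM; congr (\pi_L _).
by apply: val_inj; apply/funext => x; exact: (rmorphM (@conjc R)).
Qed.

Lemma Linfty_conjZ (z : R[i]) (a : L) : Linfty_conj (z *: a) = conjc z *: Linfty_conj a.
Proof.
elim/quotW: a => f.
rewrite -pi_LinftyZ -!pi_Linfty_conj -pi_LinftyZ; congr (\pi_L _).
by apply: val_inj; apply/funext => x; exact: (rmorphM (@conjc R)).
Qed.

Lemma Linfty_conjK (a : L) : Linfty_conj (Linfty_conj a) = a.
Proof.
elim/quotW: a => f; rewrite -!pi_Linfty_conj; congr (\pi_L _).
by apply: val_inj; apply/funext => x; exact: conjcK.
Qed.

Lemma ess_bounded_inv (f : T -> R[i]) (e : R) : ess_bounded mu f -> 0 < e ->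
  (\forall x \ae mu, e <= normc (f x)) -> ess_bounded mu (fun x => (f x)^-1).
Proof.
move=> [rf jf _] e0 fe.
pose n x := complex.Re (f x) ^+ 2 + complex.Im (f x) ^+ 2.
have mn : measurable_fun setT n by apply: measurable_funD; exact: measurable_funX.
have mni : measurable_fun setT (fun x => (n x)^-1).
  rewrite (_ : (fun _ => _) = (@powR R ^~ (-1)) \o n).
    by apply: measurableT_comp => //; exact: measurable_powR.
  by apply/funext => x /=; rewrite powR_inv1// addr_ge0// sqr_ge0.
split.
- rewrite (_ : (fun _ => _) = fun x => complex.Re (f x) * (n x)^-1).
    exact: measurable_funM.
  by apply/funext => x; rewrite /n; case: (f x).
- rewrite (_ : (fun _ => _) = fun x => - (complex.Im (f x) * (n x)^-1)).
    by apply: measurable_funN; exact: measurable_funM.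
  by apply/funext => x; rewrite /n; case: (f x).
- exists e^-1; apply: filterS fe => x fx.
  have fx0 : 0 < normc (f x) by exact: lt_le_trans fx.
  have : normc (f x) * normc (f x)^-1 = 1.
    rewrite -normcM divff ?normc1//; apply/eqP => fx00.
    by move: fx0; rewrite fx00 normc0 ltxx.
  move=> /(canRL (mulKf (lt0r_neq0 fx0))) ->; rewrite mulr1.
  by rewrite lef_pV2// posrE.
Qed.

End Linfty_calculus.

(** * Characters are bounded *)

Section characters.
Context d (T : measurableType d) (R : realType) (mu : {measure set T -> \bar R}).
Variable G : set (Linfty mu).
Local Notation fT := (ess_bounded_fun mu).
Local Notation L := (Linfty mu).
Local Notation A := (Cstar_type G).
Local Notation K := (character_space G).

Definition char_eval (k : K) (a : A) : R[i] := (set_val k : A -> R[i]) a.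

Implicit Types (k : K) (a b : A).

Lemma char_evalP k z a b : char_eval k (z *: a + b) = z * char_eval k a + char_eval k b.
Proof. by have [h _ _] := set_mem (valP k); exact: h. Qed.

Lemma char_evalM k a b : char_eval k (a * b) = char_eval k a * char_eval k b.
Proof. by have [_ h _] := set_mem (valP k); exact: h. Qed.

Lemma char_evalD k a b : char_eval k (a + b) = char_eval k a + char_eval k b.
Proof. by rewrite -[a]scale1r char_evalP mul1r scale1r. Qed.

Lemma char_eval0 k : char_eval k 0 = 0.
Proof. by apply: (addrI (char_eval k 0)); rewrite -char_evalD !addr0. Qed.

Lemma char_evalZ k z a : char_eval k (z *: a) = z * char_eval k a.
Proof. by rewrite -[z *: a]addr0 char_evalP char_eval0 addr0. Qed.

Lemma char_evalB k a b : char_eval k (a - b) = char_eval k a - char_eval k b.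
Proof. by rewrite -scaleN1r char_evalD char_evalZ mulN1r. Qed.

Lemma char_eval1 k : char_eval k 1 = 1.
Proof.
have [_ _ [a ka]] := set_mem (valP k).
by apply: (mulfI ka); rewrite mulr1; rewrite -[LHS](char_evalM k a 1) mulr1.
Qed.

Lemma Cstar_generatedP : unital_Cstar_subalgebra (Cstar_generated G).
Proof.
split.
- by move=> S [CS _]; exact: Cstar_one.
- by move=> a b Ga Gb S [CS GS]; apply: Cstar_add => //; [exact: Ga|exact: Gb].
- by move=> z a Ga S [CS GS]; apply: Cstar_scale => //; exact: Ga.
- by move=> a b Ga Gb S [CS GS]; apply: Cstar_mul => //; [exact: Ga|exact: Gb].
- by move=> a Ga S [CS GS]; apply: Cstar_conj => //; exact: Ga.
- move=> a Ga S [CS GS]; apply: (Cstar_closed CS) => e /Ga[b Gb ab].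
  by exists b => //; exact: Gb.
Qed.

Definition Cstar_sub (u : L) (Gu : Cstar_generated G u) : A := exist _ u (mem_set Gu).

Lemma Cstar_typeP a : Cstar_generated G (val a).
Proof. exact: set_mem (valP a). Qed.

(** The inverse is computed pointwise, where f is at most r, and is the uniform
limit of the partial sums of the geometric series, which are in the algebra. *)
Lemma geometric_inverse (f : fT) (r : R) : 0 < r -> r < 1 ->
  (\forall x \ae mu, normc (val f x) <= r) -> Cstar_generated G (\pi_L f) ->
  exists2 g : L, Cstar_generated G g & (1 - \pi_L f) * g = 1.
Proof.
move=> r0 r1 fr Gf.
have r10 : 0 < 1 - r by rewrite subr_gt0.
have away x : normc (val f x) <= r -> 1 - r <= normc (val (1 - f) x).
  rewrite (_ : val (1 - f) x = 1 - val f x)// => fxr.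
  have := normcD (1 - val f x) (val f x); rewrite subrK normc1; lra.
have bg : ess_bounded mu (fun x => (val (1 - f) x)^-1).
  apply: (ess_bounded_inv _ r10); first exact: set_mem (valP (1 - f)).
  by apply: filterS fr => x; exact: away.
pose g : fT := exist (fun h => h \in ess_bounded mu) _ (mem_set bg).
pose fix p n : fT := if n is n'.+1 then 1 + f * p n' else 0.
have Gp n : Cstar_generated G (\pi_L (p n)).
  have CG := Cstar_generatedP.
  elim: n => [|n IH].
    by have := Cstar_scale CG 0 (Cstar_one CG); rewrite scale0r.
  rewrite (_ : p n.+1 = 1 + f * p n)// pi_LinftyD pi_LinftyM.
  apply: (Cstar_add CG); first exact: (Cstar_one CG).
  exact: (Cstar_mul CG).
have pE n x : val (p n) x * (1 - val f x) = 1 - val f x ^+ n.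
  elim: n => [|n IH]; first by rewrite expr0 subrr; exact: mul0r.
  rewrite (_ : val (p n.+1) x = 1 + val f x * val (p n) x)//.
  by rewrite mulrDl mul1r -mulrA IH exprS mulrBr mulr1 addrA subrK.
have fgE : forall y, normc (val f y) <= r -> (1 - val f y) * val g y = 1.
  move=> x /away h; rewrite mulfV//; apply/eqP => h0.
  by move: h; rewrite (_ : val (1 - f) x = 1 - val f x)// h0 normc0; lra.
exists (\pi_L g); last first.
  have <- : \pi_L (1 - f) = 1 - \pi_L f by rewrite pi_LinftyB.
  rewrite -pi_LinftyM; transitivity (\pi_L (1 : fT)) => //.
  by apply/eqP/Linfty_eqP; apply: filterS fr => x /fgE h D; exact: h.
apply: (Cstar_closed Cstar_generatedP) => e e0.
have [n rn] : exists n, r ^+ n * (1 - r)^-1 < e.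
  have := @cvg_expr R r; rewrite ger0_norm ?ltW// => /(_ r1) h.
  have : 0 < e * (1 - r) by rewrite mulr_gt0.
  move/cvgr0_norm_lt: h => h /h[N _ /(_ N (leqnn N))] /=.
  rewrite ger0_norm ?exprn_ge0 ?(ltW r0)// => hN.
  by exists N; rewrite ltr_pdivrMr.
exists (\pi_L (p n)) => //; rewrite -pi_LinftyB.
apply: le_lt_trans (Linfty_norm_le (e := r ^+ n * (1 - r)^-1) _) _; last by rewrite lte_fin.
apply: filterS fr => x fx.
have -> : val (g - p n) x = val f x ^+ n * val g x.
  rewrite (_ : val (g - p n) x = val g x - val (p n) x)//.
  have {1}-> : val (p n) x = val (p n) x * ((1 - val f x) * val g x) by rewrite fgE// mulr1.
  by rewrite mulrA pE mulrBl mul1r opprB addrC subrK.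
have normcX (z : R[i]) m : normc (z ^+ m) = normc z ^+ m.
  by elim: m => [|m IH]; rewrite ?expr0 ?normc1// !exprS normcM IH.
have gx : normc (val g x) <= (1 - r)^-1.
  have := normcM (1 - val f x) (val g x); rewrite fgE// normc1 => h.
  have := away _ fx; rewrite (_ : val (1 - f) x = 1 - val f x)// => h'.
  by rewrite -(ler_pM2l r10) mulfV ?lt0r_neq0// [leRHS]h ler_wpM2r ?normc_ge0.
rewrite normcM normcX ler_pM ?exprn_ge0 ?normc_ge0//.
by rewrite lerXn2r ?nnegrE ?normc_ge0// ltW.
Qed.

(** Otherwise a could be scaled to have norm less than 1 and value 1 at k, so that
1 - a would be invertible and have value 0. *)
Lemma char_eval_bound k a (e : R) : 0 < e -> (Linfty_norm (val a) < e%:E)%E ->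
  normc (char_eval k a) <= e.
Proof.
move=> e0 ae; rewrite leNgt; apply/negP => eka.
set z := char_eval k a in eka.
have z0 : 0 < normc z by exact: lt_trans eka.
have zn0 : z != 0 by apply/eqP => zz; move: z0; rewrite zz normc0 ltxx.
pose f : fT := z^-1 *: repr (val a).
have fE : \pi_L f = val (z^-1 *: a) by rewrite pi_LinftyZ reprK.
have zV : normc z^-1 = (normc z)^-1.
  apply: (mulfI (lt0r_neq0 z0)); rewrite -normcM !divff ?normc1//.
  exact: lt0r_neq0.
have [||||g Gg fg] := @geometric_inverse f (e / normc z).
- by rewrite divr_gt0.
- by rewrite ltr_pdivrMr// mul1r.
- apply: filterS (Linfty_norm_lt ae) => x ax.
  rewrite (_ : val f x = z^-1 * val (repr (val a)) x)// normcM zV mulrC.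
  by rewrite ler_pM2r// invr_gt0.
- rewrite fE; exact: Cstar_typeP.
have : (1 - z^-1 *: a) * Cstar_sub Gg = 1 by apply: val_inj; move: fg; rewrite fE => h; exact: h.
move=> /(congr1 (char_eval k)); rewrite char_evalM char_evalB char_eval1 char_evalZ.
by rewrite mulVf// subrr mul0r => /esym/eqP; rewrite oner_eq0.
Qed.

End characters.

(** * Compactness and convergence of characters *)

Section character_topology.
Context d (T : measurableType d) (R : realType) (mu : {measure set T -> \bar R}).
Variable G : set (Linfty mu).
Local Notation L := (Linfty mu).
Local Notation A := (Cstar_type G).
Local Notation K := (character_space G).
Implicit Types (k : K) (a b : A).

Lemma char_eval_continuous a : continuous (fun k : K => char_eval k a : R[i]^o).
Proof. exact: continuous_eval_subspace_ptws. Qed.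

Lemma cvg_complexD (X : Type) (F : set_system X) (f g : X -> R[i]) (y z : R[i]) :
  Filter F -> f x @[x --> F] --> (y : R[i]^o) -> g x @[x --> F] --> (z : R[i]^o) ->
  f x + g x @[x --> F] --> (y + z : R[i]^o).
Proof. by move=> FF fy gz; exact: (@cvgD _ R[i]^o _ _ FF f g y z fy gz). Qed.

Lemma cvg_complexM (X : Type) (F : set_system X) (f g : X -> R[i]) (y z : R[i]) :
  Filter F -> f x @[x --> F] --> (y : R[i]^o) -> g x @[x --> F] --> (z : R[i]^o) ->
  f x * g x @[x --> F] --> (y * z : R[i]^o).
Proof. by move=> FF fy gz; exact: (@cvgM _ _ _ FF f g y z fy gz). Qed.

Lemma cvg_complex_cst (X : Type) (F : set_system X) (z : R[i]) : Filter F ->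
  (fun=> z) x @[x --> F] --> (z : R[i]^o).
Proof. by move=> FF B /nbhs_singleton Bz; apply: (@filterE _ F). Qed.

Lemma ultra_fmap (X Y : Type) (F : set_system X) (f : X -> Y) :
  UltraFilter F -> UltraFilter (f @ F).
Proof.
move=> UF; split=> [|H PH FH]; first exact: fmap_proper_filter.
apply/seteqP; split=> [B HB|]; last exact: FH.
have [//|FnB] := in_ultra_setVsetC (f @^-1` B) UF.
have HnB : H (~` B) by exact: FH.
by have [y []] := filter_ex (filterI HB HnB).
Qed.

Lemma bounded_ultra_cvg (X : Type) (F : set_system X) (f : X -> R[i]) (M : R) :
  UltraFilter F -> (forall x, normc (f x) <= M) ->
  exists z : R[i], f x @[x --> F] --> (z : R[i]^o).
Proof.
move=> UF fM.
have real_part (g : X -> R) : (forall x, `|g x| <= M) -> exists y : R, g x @[x --> F] --> y.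
  move=> gM; have UG := ultra_fmap g UF.
  have := @segment_compact R (- M) M; rewrite compact_ultra => /(_ _ UG)[|y [_ gy]].
    by apply: (@filterE _ F) => x /=; rewrite in_itv /= -ler_norml; exact: gM.
  by exists y.
have abs_le (x y : R) : `|x| <= Num.sqrt (x ^+ 2 + y ^+ 2).
  by rewrite -sqrtr_sqr ler_wsqrtr// lerDl sqr_ge0.
have [|p fp] := real_part (fun x => complex.Re (f x)).
  by move=> x; apply: le_trans (fM x); case: (f x) => u v /=.
have [|q fq] := real_part (fun x => complex.Im (f x)).
  by move=> x; apply: le_trans (fM x); case: (f x) => u v /=; rewrite addrC.
exists (p +i* q)%C => B /nbhs_normc[e e0 eB].
have e20 : 0 < e / 2 by lra.
move: fp fq => /cvgrPdist_lt/(_ _ e20) fp /cvgrPdist_lt/(_ _ e20) fq.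
apply: filterS2 fp fq => x xp xq; apply: eB.
move: xp xq; case: (f x) => u v /= xp xq.
apply: le_lt_trans (normc_le_ReIm _ _) _.
by rewrite distrC [X in _ + X]distrC; lra.
Qed.

(** The values of an ultrafilter of characters at each a are bounded, hence
converge, and the limit is again a character. *)
Lemma compact_characters : compact [set: K].
Proof.
rewrite compact_ultra => F UF _.
have /choice[phi phiP] : forall a, exists z : R[i],
    char_eval k a @[k --> F] --> (z : R[i]^o).
  move=> a.
  have [M M0 aM] := Linfty_norm_finite (val a).
  by apply: (bounded_ultra_cvg (M := M)) => // k; exact: char_eval_bound aM.
have uniq (f : K -> R[i]) (y z : R[i]) : f k @[k --> F] --> (y : R[i]^o) ->
    f k @[k --> F] --> (z : R[i]^o) -> y = z.
  by move=> fy fz; apply: (cvg_unique (@norm_hausdorff _ R[i]^o) fy fz).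
have phiK : characters phi.
  split=> [z a b|a b|].
  - apply: (uniq (fun k => char_eval k (z *: a + b))); first exact: phiP.
    under eq_fun do rewrite char_evalP.
    apply: (cvg_complexD _ _ (phiP b)); apply: (cvg_complexM _ _ (phiP a)).
    exact: cvg_complex_cst.
  - apply: (uniq (fun k => char_eval k (a * b))); first exact: phiP.
    under eq_fun do rewrite char_evalM.
    exact: (cvg_complexM _ (phiP a) (phiP b)).
  - exists 1; suff -> : phi 1 = 1 by exact: oner_neq0.
    apply: (uniq (fun k => char_eval k 1)); first exact: phiP.
    under eq_fun do rewrite char_eval1.
    exact: cvg_complex_cst.
exists (exist _ phi (mem_set phiK)); split=> //.
by apply: cvg_subspace_ptws => a; exact: phiP.
Qed.

(** The elements at which the values converge, together with their conjugates,
form a closed subalgebra, as characters are uniformly bounded. Conjugates are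
carried along because closure under conjugation is required of S. *)
Lemma cvg_characters (F : set_system K) (k0 : K) : Filter F ->
  (forall u (Gu : G u) a, val a = u -> char_eval k a @[k --> F] --> (char_eval k0 a : R[i]^o)) ->
  (forall u, G u -> Linfty_conj u = u) ->
  F --> k0.
Proof.
move=> FF FG Gconj.
pose P a := char_eval k a @[k --> F] --> (char_eval k0 a : R[i]^o).
pose S := [set u : L | [/\ Cstar_generated G u, forall a, val a = u -> P a &
  forall a, val a = Linfty_conj u -> P a]].
have CG := Cstar_generatedP G.
have PD a b : P a -> P b -> P (a + b).
  move=> Pa Pb; have := cvg_complexD FF Pa Pb; rewrite -char_evalD.
  by under eq_fun do rewrite -char_evalD.
have PM a b : P a -> P b -> P (a * b).
  move=> Pa Pb; have := cvg_complexM FF Pa Pb; rewrite -char_evalM.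
  by under eq_fun do rewrite -char_evalM.
have P1 : P 1.
  rewrite /P char_eval1 (_ : (fun k => char_eval k 1) = fun=> 1).
    exact: cvg_complex_cst.
  by apply/funext => k; rewrite char_eval1.
have PZ z a : P a -> P (z *: a).
  move=> Pa; have := cvg_complexM FF (@cvg_complex_cst K F z FF) Pa; rewrite -char_evalZ.
  by under eq_fun do rewrite -char_evalZ.
have Plim a : (forall e : R, 0 < e -> exists2 b, P b & (Linfty_norm (val a - val b)%R <= e%:E)%E) ->
    P a.
  move=> ab B /nbhs_normc[e e0 eB]; have e80 : 0 < e / 8 by lra.
  have [b Pb abe] := ab _ e80.
  have e4 : ((e / 8)%:E < (e / 4)%:E)%E by rewrite lte_fin; lra.
  have bd k : normc (char_eval k a - char_eval k b) <= e / 4.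
    rewrite -char_evalB; apply: char_eval_bound; first by lra.
    exact: le_lt_trans abe e4.
  have e40 : 0 < e / 4 by lra.
  have : F [set k | normc (char_eval k b - char_eval k0 b) < e / 4].
    by apply: (Pb [set z : R[i]^o | normc (z - char_eval k0 b) < e / 4]);
      apply/nbhs_normc; exists (e / 4).
  move=> Fb; apply: (@filterS _ F _ _ _ _ Fb) => k /= kb; apply: eB.
  have := normc_triangle (char_eval k a) (char_eval k b) (char_eval k0 a).
  have := normc_triangle (char_eval k b) (char_eval k0 b) (char_eval k0 a).
  have := bd k; have := bd k0; rewrite (normc_dist (char_eval k0 b)); lra.
have conjE (u : L) (Gu : Cstar_generated G u) : Cstar_generated G (Linfty_conj u).
  exact: (Cstar_conj CG).
have SG : unital_Cstar_subalgebra S.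
  split.
  - split; [exact: Cstar_one|move=> a a1|rewrite Linfty_conj1 => a a1];
      by rewrite (_ : a = 1)//; exact: val_inj.
  - move=> u v [Gu Pu Pu'] [Gv Pv Pv']; split; first exact: (Cstar_add CG).
      move=> a auv; rewrite (_ : a = Cstar_sub Gu + Cstar_sub Gv); last exact: val_inj.
      by apply: PD; [exact: Pu|exact: Pv].
    rewrite Linfty_conjD => a auv.
    rewrite (_ : a = Cstar_sub (conjE _ Gu) + Cstar_sub (conjE _ Gv)); last exact: val_inj.
    by apply: PD; [exact: Pu'|exact: Pv'].
  - move=> z u [Gu Pu Pu']; split; first exact: (Cstar_scale CG).
      move=> a au; rewrite (_ : a = z *: Cstar_sub Gu); last exact: val_inj.
      by apply: PZ; exact: Pu.
    rewrite Linfty_conjZ => a au.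
    rewrite (_ : a = conjc z *: Cstar_sub (conjE _ Gu)); last exact: val_inj.
    by apply: PZ; exact: Pu'.
  - move=> u v [Gu Pu Pu'] [Gv Pv Pv']; split; first exact: (Cstar_mul CG).
      move=> a auv; rewrite (_ : a = Cstar_sub Gu * Cstar_sub Gv); last exact: val_inj.
      by apply: PM; [exact: Pu|exact: Pv].
    rewrite Linfty_conjM => a auv.
    rewrite (_ : a = Cstar_sub (conjE _ Gu) * Cstar_sub (conjE _ Gv)); last exact: val_inj.
    by apply: PM; [exact: Pu'|exact: Pv'].
  - by move=> u [Gu Pu Pu']; split; [exact: conjE|exact: Pu'|rewrite Linfty_conjK].
  - move=> u approx; split.
    + by apply: (Cstar_closed CG) => e /approx[b [Gb _ _] ub]; exists b.
    + move=> a au; apply: Plim => e /approx[b [Gb Pb _] ub].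
      by exists (Cstar_sub Gb); [exact: Pb|rewrite au; exact: ltW].
    + move=> a au; apply: Plim => e /approx[b [Gb _ Pb] ub].
      by exists (Cstar_sub (conjE _ Gb)); [exact: Pb|rewrite au; exact: Linfty_norm_conjB].
have GS : G `<=` S.
  move=> u Gu; split; first by move=> S' [_ GS']; exact: GS'.
    exact: FG.
  rewrite (Gconj _ Gu); exact: FG.
apply: cvg_subspace_ptws => a.
have [_ Pa _] : S (val a) := Cstar_typeP a (conj SG GS).
exact: Pa.
Qed.

End character_topology.

(** * Characters as cuts *)

Section ray_characters.
Context (R : realType) (E : topologicalZmodType) (le : rel E).
Hypothesis le_linear : linear_order le.
Hypothesis order_topologyE : (@open E : set (set E)) = order_open le.
Variable mu : {measure set (borelType E) -> \bar R}.
Local Notation G := (ray_classes mu le).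
Local Notation L := (Linfty mu).
Local Notation fT := (ess_bounded_fun mu).
Local Notation A := (Cstar_type G).
Local Notation K := (character_space G).
Implicit Types (k : K) (x y t : E).

Let nle x y : ~~ le x y -> le y x.
Proof. by have [_ _ _ t] := le_linear; have /orP[->//|->] := t x y. Qed.

Lemma urayE x y : uray le x y <-> ~~ le y x.
Proof.
have [r a _ _] := le_linear; split=> [/andP[xy]|yx].
  by apply: contra => yx; apply/eqP/a; rewrite xy yx.
by apply/andP; split; [exact: nle|apply: contraNneq yx => ->; exact: r].
Qed.

Lemma lrayE x y : lray le x y <-> ~~ le x y.
Proof.
have [r a _ _] := le_linear; split=> [/andP[xy]|yx].
  by apply: contra => yx; apply/eqP/a; rewrite xy yx.
by apply/andP; split; [exact: nle|apply: contraNneq yx => ->; exact: r].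
Qed.

Lemma open_uray x : open (uray le x).
Proof. by rewrite order_topologyE => S [_ GS]; apply: GS; right; exists x. Qed.

Lemma open_lray x : open (lray le x).
Proof. by rewrite order_topologyE => S [_ GS]; apply: GS; left; exists x. Qed.

Definition ray_fun t : fT := exist (fun h => h \in ess_bounded mu) _
  (mem_set (ess_bounded_indic mu (sub_sigma_algebra (open_uray t)))).

Lemma ray_class_generated t : Cstar_generated G (\pi_L (ray_fun t)).
Proof. by move=> S [_ GS]; apply: GS; exists (ray_fun t) => //; exists t. Qed.

Definition ray t : A := Cstar_sub (ray_class_generated t).

Lemma ray_mul x y : le x y -> ray x * ray y = ray y.
Proof.
move=> xy; apply: val_inj; transitivity (\pi_L (ray_fun x * ray_fun y)).
  by rewrite pi_LinftyM.
congr (\pi_L _); apply: val_inj; apply/funext => z.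
rewrite (_ : val _ z = \1_(uray le x) z * \1_(uray le y) z)//.
rewrite (_ : val (ray_fun y) z = \1_(uray le y) z)// !indicE.
have [zy|_] := boolP (z \in uray le y); last by rewrite mulr0.
have -> : z \in uray le x; last by rewrite mulr1.
move: zy; rewrite !inE => /urayE zy; apply/urayE; apply: contra zy => zx.
by have [_ _ tr _] := le_linear; exact: tr zx xy.
Qed.

(** The value at the idempotent f^t is 0 or 1. *)
Definition cut k t : bool := char_eval k (ray t) == 1.

Lemma char_eval_ray k t : char_eval k (ray t) = (cut k t)%:R.
Proof.
have [r _ _ _] := le_linear.
have := char_evalM k (ray t) (ray t); rewrite ray_mul// /cut.
case: eqP => [->//|/eqP h1 /eqP]; rewrite -subr_eq0 -{1}[char_eval k _]mulr1 -mulrBr.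
by rewrite mulf_eq0 subr_eq0 [1 == _]eq_sym (negbTE h1) orbF => /eqP.
Qed.

Lemma cut_mono_ray k x y : le x y -> cut k y -> cut k x.
Proof.
move=> xy ky; have := char_evalM k (ray x) (ray y); rewrite ray_mul// !char_eval_ray ky.
case: (cut k x) => //=; rewrite mul0r => /eqP; by rewrite oner_eq0.
Qed.

Lemma cut_locally_constant k t : \forall k' \near k, cut k' t = cut k t.
Proof.
have h1 : normc (char_eval k (ray t) - char_eval k (ray t)) < 1 by rewrite subrr normc0.
have := nbhs_dist_lt (@char_eval_continuous _ _ _ _ _ (ray t) k) h1.
apply: filterS => k'; rewrite !char_eval_ray.
by case: (cut k' t) (cut k t) => [] [] //; rewrite ?mulr1n ?mulr0n ?subr0 ?sub0r ?normcN normc1 ltxx.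
Qed.

Lemma ray_conj u : G u -> Linfty_conj u = u.
Proof.
move=> [f [t ft] <-]; rewrite -pi_Linfty_conj; congr (\pi_L _).
apply: val_inj; apply/funext => x.
rewrite (_ : val (fun_conj f) x = conjc (val f x))// ft indicE.
by case: (_ \in _); rewrite /= oppr0.
Qed.

(** The basic sets at k form a filter base along which the value at each f^t is
eventually constant, so that it converges to k. *)
Lemma cut_base_ray k (U : set K) : nbhs k U -> exists s t : option E,
  [/\ oapp (cut k) true s, ~~ oapp (cut k) false t &
   forall k', oapp (cut k') true s -> ~~ oapp (cut k') false t -> U k'].
Proof.
have [_ _ _ tot] := le_linear.
pose F : set_system K := [set V | exists s t : option E,
  [/\ oapp (cut k) true s, ~~ oapp (cut k) false t &
   forall k', oapp (cut k') true s -> ~~ oapp (cut k') false t -> V k']].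
have directed_in (s s' : option E) : oapp (cut k) true s -> oapp (cut k) true s' ->
    exists2 r, oapp (cut k) true r & forall k', oapp (cut k') true r ->
      oapp (cut k') true s /\ oapp (cut k') true s'.
  case: s s' => [x|] [y|] /= kx ky; [|by exists (Some x)|by exists (Some y)|by exists None].
  have /orP[xy|yx] := tot x y; [exists (Some y)|exists (Some x)] => // k' /= k'z; split=> //;
    exact: cut_mono_ray k'z.
have directed_out (s s' : option E) : ~~ oapp (cut k) false s -> ~~ oapp (cut k) false s' ->
    exists2 r, ~~ oapp (cut k) false r & forall k', ~~ oapp (cut k') false r ->
      ~~ oapp (cut k') false s /\ ~~ oapp (cut k') false s'.
  case: s s' => [x|] [y|] /= kx ky; [|by exists (Some x)|by exists (Some y)|by exists None].
  have /orP[xy|yx] := tot x y; [exists (Some x)|exists (Some y)] => // k' /= k'z; split=> //;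
    by apply: contra k'z; exact: cut_mono_ray.
have FF : Filter F.
  split; first by exists None, None.
    move=> V W [s [t [ks kt V_]]] [s' [t' [ks' kt' W_]]].
    have [r kr rP] := directed_in _ _ ks ks'; have [q kq qP] := directed_out _ _ kt kt'.
    exists r, q; split=> // k' /rP[? ?] /qP[? ?]; split; [exact: V_|exact: W_].
  by move=> V W VW [s [t [ks kt V_]]]; exists s, t; split=> // k' h1 h2; apply/VW/V_.
suff : F --> k by apply.
apply: cvg_characters => [u [f [t ft] fu] a au|u]; last exact: ray_conj.
have {u fu au f ft} -> : a = ray t.
  apply: val_inj; rewrite au -fu; congr (\pi_L _); exact: val_inj.
move=> B /nbhs_singleton Bk.
have same k' : cut k' t = cut k t -> B (char_eval k' (ray t)).
  by move=> h; rewrite char_eval_ray h -char_eval_ray.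
have [kt|kt] := boolP (cut k t).
  by exists (Some t), None; split=> // k' /= k't _; apply: same; rewrite kt k't.
by exists None, (Some t); split=> // k' _ /= /negbTE k't; apply: same; rewrite k't (negbTE kt).
Qed.

(** Open intervals are not empty, since E is connected, so they meet a countable
dense set. *)
Lemma order_dense_sequence : connected [set: E] -> separable E ->
  exists d : nat -> E, forall x y, ~~ le y x ->
    exists n, ~~ le (d n) x /\ ~~ le y (d n).
Proof.
move=> Econn [D /countable_injP[f fI] Ddense].
exists (fun n => xget 0 [set x | D x /\ f x = n]) => x y xy.
have [z [xz zy]] : (uray le x `&` lray le y) !=set0.
  apply: contrapT => none.
  have lrayC : lray le y = ~` uray le x.
    apply/seteqP; split=> [z zy xz|z xz]; first by apply: none; exists z.
    apply/lrayE; apply/negP => yz; apply: xz; apply/urayE; apply: contra xy => zx.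
    by have [_ _ tr _] := le_linear; exact: tr yz zx.
  have ly : lray le y = setT.
    apply: Econn; first by exists x; apply/lrayE.
      by exists (lray le y); [exact: open_lray|rewrite setTI].
    exists (~` uray le x); last by rewrite setTI.
    by apply: open_closedC; exact: open_uray.
  have /lrayE : lray le y y by rewrite ly.
  by have [r _ _ _] := le_linear; rewrite r.
have [w [[/urayE xw /lrayE wy] Dw]] :=
  Ddense _ (ex_intro _ z (conj xz zy)) (openI (open_uray x) (open_lray y)).
exists (f w); case: xgetP => [v _ [Dv fv]|/(_ w)[]]; last by split.
by rewrite (fI v w) ?inE.
Qed.

End ray_characters.

Theorem mainTheorem4 (R : realType) (E : topologicalZmodType) (le : rel E)
    (le_linear : linear_order le)
    (le_sub : forall a b : E, le a b <-> le (a - b) 0)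
    (order_topologyE : (@open E : set (set E)) = order_open le)
    (E_uncountable : ~ countable [set: E])
    (E_locally_compact : locally_compact [set: E])
    (E_separable : separable E)
    (E_connected : connected [set: E])
    (mu : {measure set (borelType E) -> \bar R})
    (mu_haar : haar_measure mu)
    (CH : continuum_hypothesis R) :
  let K := character_space (ray_classes mu le) in
  let CK := Cp K R in
  (measurable : set (set (borelType CK * borelType CK))) =
  <<s (@open (CK * CK)%type) >>.
Proof.
move=> K CK.
have [d dP] := order_dense_sequence le_linear order_topologyE E_connected E_separable.
apply: (@cut_space_prod_borel R K E le (cut order_topologyE (mu := mu)) d) => //.
  exact: compact_characters.
split=> //.
- by move=> k x y; exact: cut_mono_ray.
- move=> k x kx; have := cut_locally_constant le_linear order_topologyE k x.
  by apply: filterS => k' ->.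
- move=> k x kx; have := cut_locally_constant le_linear order_topologyE k x.
  by apply: filterS => k' ->.
- by move=> k U; exact: cut_base_ray.
Qed.
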